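(* Assume that the ambiguity size $r$ and the revenue target $\tau$ satisfy $$\tau=\tau^{\mathsf{Equiv}}(r):=\Pi_{RO}^*(r)+\frac{r}{\sum_{j\in[J]}\ln\left[w_j(\Pi_{RO}^*(r))/u_j(\Pi_{RO}^*(r))\right]},\qquad J=J(\Pi_{RO}^*(r)).$$ Then the robust optimization problem $$\sup_{(q,m)\in\mathcal M}\ \inf_{P\in\mathcal W(P_0,r)}\mathbb E_P[m(\tilde v)]$$ and the robust satisficing problem $$\inf_{(q,m)\in\mathcal M,\ k>0}k\quad\text{s.t.}\quad\tau-\mathbb E_P[m(\tilde v)]\le k\,d(P,P_0)\quad\forall P\in\mathcal P$$ are equivalent, in that they result in the same optimal selling mechanism: $(q_{RO}^*,m_{RO}^* )=(q_{RS}^*,m_{RS}^* )$.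
   Context: $\mathcal P$ is the set of probability distributions supported on $[0,1]$; $\bar P=1-P$; $P_0\in\mathcal P$ is a reference distribution with mean $\mu_0$; $d(P,P_0)=\int_0^1|\bar P(x)-\bar P_0(x)|\,\mathrm dx$; $\mathcal W(P_0,r)=\{P\in\mathcal P:d(P,P_0)\le r\}$, with $0<r<\mu_0$. The set of direct mechanisms is $\mathcal M=\{(q,m):[0,1]\to[0,1]\times\mathbb R: q\text{ non-decreasing},\ m(v)=\int_0^vx\,\mathrm dq(x)\ \forall v\}$, the (Riemann–Stieltjes) integral being $vq(v)-\int_0^vq(x)\,\mathrm dx$. $\Pi_0:=\max_{x\in[0,1]}x\,\mathbb P_{P_0}(\tilde v\ge x)$; for $\pi\in[0,\Pi_0]$, $d(\pi):=\int_0^1(\bar P_0(x)-\pi/x)^+\mathrm dx$. Standing assumption: for every $\pi\in[0,\Pi_0]$ there exist an integer $J(\pi)\ge0$ and $0\le u_1(\pi)<w_1(\pi)<\dots<u_{J(\pi)}(\pi)<w_{J(\pi)}(\pi)\le1$ such that $\{x\in(0,1):\bar P_0(x)>\pi/x\}$ coincides, up to finitely many points, with $\bigcup_j(u_j(\pi),w_j(\pi))$, and $\bar P_0(x)\ge\pi/x$ on $\bigcup_j[u_j(\pi),w_j(\pi))$. For given $\pi$ and coefficient $a>0$, writing $u_j=u_j(\pi)$, $w_j=w_j(\pi)$, $J=J(\pi)$, $u_0=w_0=0$, $u_{J+1}=1$, define the mechanism $M(\pi,a)$ by, for $j=0,\dots,J$, $$(q(v),m(v))=\begin{cases}a\left(\sum_{i\in[j-1]}\ln\frac{w_i}{u_i}+\ln\frac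 v{u_j},\ \sum_{i\in[j-1]}(w_i-u_i)+(v-u_j)\right),&v\in[u_j,w_j),\\ a\left(\sum_{i\in[j]}\ln\frac{w_i}{u_i},\ \sum_{i\in[j]}(w_i-u_i)\right),&v\in[w_j,u_{j+1}),\end{cases}$$ and $(q(1),m(1))=(1,a\sum_{i\in[J]}(w_i-u_i))$ (empty sums are $0$, $[N]=\{1,\dots,N\}$). RO optimal mechanism: $\Pi_{RO}^*(r)$ is the unique $\pi\in[0,1]$ with $\int_0^1(\bar P_0(x)-\pi/x)^+\mathrm dx=r$ (it is the optimal value of the RO problem), and $(q_{RO}^*,m_{RO}^* )=M(\Pi_{RO}^*(r),\alpha)$ with $\alpha=1/\sum_{j\in[J]}\ln(w_j/u_j)$ evaluated at $\pi=\Pi_{RO}^*(r)$. RS optimal mechanism: $\rho^*(k)=\min_{\pi\in[0,\Pi_0]}[\pi+k\,d(\pi)]$ with minimizer $\pi^*(k)$, $k_{RS}^*=(\rho^* )^{-1}(\tau)$, and $(q_{RS}^*,m_{RS}^* )=M(\pi^*(k_{RS}^* ),k_{RS}^* )$. *)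

(* Defs.v *)
From HB Require Import structures.
From mathcomp Require Import all_boot all_order all_algebra.
From mathcomp Require Import all_classical all_reals all_analysis.

Set Implicit Arguments.
Unset Strict Implicit.
Unset Printing Implicit Defensive.

Import Order.TTheory GRing.Theory Num.Theory.
Import numFieldNormedType.Exports.

Local Open Scope classical_set_scope.
Local Open Scope ring_scope.

Section distributions.
Context {R : realType}.

Definition distr : Type := probability (measurableTypeR R) R.

Implicit Types P : distr.

Definition supported01 P : Prop := P `[0, 1]%classic = 1%E.

Definition survival P (x : R) : R := 1 - fine (P `]-oo, x]%classic).

(* Mechanisms are functions on [0, 1], represented by functions on R whose
   values outside [0, 1] are irrelevant: expectations under distributions
   supported on [0, 1] are therefore taken over [0, 1] only. *)
Definition expect P (f : R -> R) : R := \int[P]_(x in `[0, 1]) f x.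

Definition mean P : R := expect P id.

Definition dist P (P0 : distr) : R :=
  \int[lebesgue_measure]_(x in `[0, 1]) `|survival P x - survival P0 x|.

Definition ambiguity (P0 : distr) (r : R) : set distr :=
  [set P | supported01 P /\ dist P P0 <= r].

End distributions.

Arguments distr : clear implicits.

Section mechanisms.
Context {R : realType}.

(* The Riemann-Stieltjes integral of x dq(x) over [0, v] is
   v q(v) - int_0^v q(x) dx. *)
Definition direct_mechanism (q m : R -> R) : Prop :=
  [/\ forall v, v \in `[0, 1] -> 0 <= q v <= 1,
      {in `[0, 1] &, {homo q : x y / x <= y}} &
      forall v, v \in `[0, 1] ->
        m v = v * q v - \int[lebesgue_measure]_(x in `[0, v]) q x].

Definition RO_worst_case (P0 : distr R) (r : R) (m : R -> R) : \bar R :=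
  ereal_inf [set (expect P m)%:E | P in ambiguity P0 r].

Definition RO_value (P0 : distr R) (r : R) : \bar R :=
  ereal_sup [set RO_worst_case P0 r qm.2 |
    qm in [set qm : (R -> R) * (R -> R) | direct_mechanism qm.1 qm.2]].

Definition RO_optimal (P0 : distr R) (r : R) (q m : R -> R) : Prop :=
  direct_mechanism q m /\ RO_worst_case P0 r m = RO_value P0 r.

Definition RS_feasible (P0 : distr R) (tau : R) (q m : R -> R) (k : R) : Prop :=
  [/\ direct_mechanism q m, 0 < k &
      forall P : distr R, supported01 P ->
        tau - expect P m <= k * dist P P0].

Definition RS_value (P0 : distr R) (tau : R) : \bar R :=
  ereal_inf [set k%:E | k in [set k : R | exists q m, RS_feasible P0 tau q m k]].

Definition RS_optimal (P0 : distr R) (tau : R) (q m : R -> R) (k : R) : Prop :=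
  RS_feasible P0 tau q m k /\ k%:E = RS_value P0 tau.

End mechanisms.

Section level_intervals.
Context {R : realType}.

(* The maximum over [0, 1] is attained, x |-> x P0([x, +oo[) being upper
   semicontinuous. *)
Definition Pi0 (P0 : distr R) : R :=
  sup [set x * fine (P0 `[x, +oo[%classic) | x in `[0, 1]].

(* The convention 0^-1 = 0 only affects the integrand at x = 0. *)
Definition excess (P0 : distr R) (p : R) : R :=
  \int[lebesgue_measure]_(x in `[0, 1]) Num.max (survival P0 x - p / x) 0.

(* A finite family of intervals [lo j, hi j), j = 1, ..., num; the values of
   lo and hi at other indices are irrelevant. *)
Record intervals : Type :=
  Intervals { num : nat; lo : nat -> R; hi : nat -> R }.

Definition level_intervals (P0 : distr R) (p : R) (I : intervals) : Prop :=
  [/\ forall j, (1 <= j <= num I)%N -> [/\ 0 <= lo I j, lo I j < hi I j & hi I j <= 1],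
      forall j, (1 <= j < num I)%N -> hi I j < lo I j.+1,
      finite_set
        ([set x | 0 < x < 1 /\ p / x < survival P0 x] `+`
         [set x | exists2 j, (1 <= j <= num I)%N & lo I j < x < hi I j]) &
      forall j x, (1 <= j <= num I)%N -> lo I j <= x < hi I j ->
        p / x <= survival P0 x].

Definition sum_log (I : intervals) : R :=
  \sum_(1 <= j < (num I).+1) ln (hi I j / lo I j).

(* Endpoints with the conventions u_0 = w_0 = 0 and u_{J+1} = 1. *)
Definition lo_ext (I : intervals) (j : nat) : R :=
  if j == 0%N then 0 else if (j <= num I)%N then lo I j else 1.

Definition hi_ext (I : intervals) (j : nat) : R :=
  if j == 0%N then 0 else hi I j.

(* The pair (q v, m v); it is (0, 0) by convention outside [0, 1]. *)
Definition mech (I : intervals) (a v : R) : R * R :=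
  if v == 1 then (1, a * \sum_(1 <= i < (num I).+1) (hi I i - lo I i))
  else if [pick j : 'I_(num I).+1 | lo_ext I j <= v < hi_ext I j] is Some j then
    (a * (\sum_(1 <= i < j) ln (hi I i / lo I i) + ln (v / lo_ext I j)),
     a * (\sum_(1 <= i < j) (hi I i - lo I i) + (v - lo_ext I j)))
  else if [pick j : 'I_(num I).+1 | hi_ext I j <= v < lo_ext I j.+1] is Some j then
    (a * \sum_(1 <= i < j.+1) ln (hi I i / lo I i),
     a * \sum_(1 <= i < j.+1) (hi I i - lo I i))
  else (0, 0).

Definition mech_q (I : intervals) (a v : R) : R := (mech I a v).1.
Definition mech_m (I : intervals) (a v : R) : R := (mech I a v).2.

End level_intervals.

Arguments intervals : clear implicits.

Section optimal_mechanisms.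
Context {R : realType}.
Variables (P0 : distr R) (I : R -> intervals R).

Definition Pi_RO (r : R) : R :=
  get [set p : R | 0 <= p <= 1 /\ excess P0 p = r].

Definition alpha_RO (r : R) : R := 1 / sum_log (I (Pi_RO r)).

Definition q_RO (r : R) : R -> R := mech_q (I (Pi_RO r)) (alpha_RO r).
Definition m_RO (r : R) : R -> R := mech_m (I (Pi_RO r)) (alpha_RO r).

Definition tau_equiv (r : R) : R := Pi_RO r + r / sum_log (I (Pi_RO r)).

Definition rho (k : R) : R :=
  inf [set p + k * excess P0 p | p in `[0, Pi0 P0]].

Definition pi_RS (k : R) : R :=
  get [set p : R | p \in `[0, Pi0 P0] /\ p + k * excess P0 p = rho k].

Definition k_RS (tau : R) : R := get [set k : R | 0 < k /\ rho k = tau].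

Definition q_RS (tau : R) : R -> R := mech_q (I (pi_RS (k_RS tau))) (k_RS tau).
Definition m_RS (tau : R) : R -> R := mech_m (I (pi_RS (k_RS tau))) (k_RS tau).

End optimal_mechanisms.

(* Main.v *)
Require Import Defs.
From HB Require Import structures.
From mathcomp Require Import all_boot all_order all_algebra.
From mathcomp Require Import all_classical all_reals all_analysis.
From mathcomp Require Import measurable_realfun ring lra.

Set Implicit Arguments.
Unset Strict Implicit.
Unset Printing Implicit Defensive.

Import Order.TTheory GRing.Theory Num.Theory.
Import numFieldNormedType.Exports.
Local Open Scope classical_set_scope.
Local Open Scope ring_scope.

(** Write F0 for the distribution function of P0 and, for a level p > 0, let U
    be the set of x in [0, 1] with p / x < 1 - F0 x and S the integral of 1 / x
    over U, which is the sum of the ln (w_j / u_j).  Everything takes place at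
    the level p with [excess P0 p = r] and with the coefficient a = 1 / S.

    The mechanism of this level charges a value v exactly a times the Lebesgue
    measure of U below v.  By Tonelli ([tail_integral]), its expected revenue
    under P is a times the integral of the survival function of P over U.
    That integral is at least r + p S - d(P, P0)
    ([level_survival_lower_bound]), whence the guarantee
    p + a (r - d(P, P0)) for every P ([mech_guarantee]).  The same inequality
    gives the value p of the robust problem on the ambiguity ball, and the
    constraint with slope a of the satisficing problem for the target
    tau = p + a r.

    Conversely, let P* have the survival function min (1 - F0 x, p / x)
    ([truncated_distr]).  It is at distance r from P0, and since no posted price
    earns more than p under it, no direct mechanism does
    ([revenue_upper_bound]).  So p is the best robust revenue, and a feasible
    slope k must satisfy tau - p <= k r, that is a <= k.

    It remains to see that the satisficing parameters recover a and p.  The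
    line of slope - S through p supports the graph of [excess P0], so p
    minimizes p' + a excess P0 p'; the minimizer is unique ([tradeoff_strict_min])
    because x (1 - F0 x) jumps only downwards and therefore takes values
    between any two levels below its supremum on a set of positive measure
    ([posted_price_crossing]).  Uniqueness also makes a the only coefficient
    with [rho P0 a = tau] ([k_RS_tradeoff]).  Both mechanisms are then the
    mechanism of the level p with the coefficient a. *)

(** * Measurability and integrability on the unit interval *)

Lemma nondecreasing_measurable01 (R : realType) (f : R -> R) :
  {in `[0, 1] &, {homo f : x y / x <= y}} -> measurable_fun (`[0, 1] : set R) f.
Proof.
move=> f_nd; pose c (x : R) := Num.max 0 (Num.min x 1).
have c01 x : c x \in `[0, 1].
  by rewrite in_itv /= /c le_max lexx ge_max ler01 ge_min lexx orbT.
(* composing with the projection onto [0, 1] makes f monotone on the whole line *)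
apply: (eq_measurable_fun (f \o c)) => [x|].
  by rewrite inE /= in_itv /= /c => /andP[x0 x1]; rewrite min_l// max_r.
apply: nondecreasing_measurable => // x y xy; apply: f_nd => //.
by rewrite /c le_max2 ?le_min2.
Qed.

Lemma inv_measurable01 (R : realType) :
  measurable_fun (`[0, 1] : set R) (fun x : R => x^-1).
Proof.
(* the identity with the real power holds at 0 too, both sides being 0 *)
apply: (eq_measurable_fun (fun x : R => x `^ (-1))) => [x|].
  by rewrite inE /= in_itv /= => /andP[x0 _]; rewrite powR_inv1.
by apply: measurable_funTS; exact: measurable_powR.
Qed.

Lemma bounded_integrable01 (R : realType)
    (mu : {measure set (measurableTypeR R) -> \bar R}) (f : R -> R) (M : R) :
  (mu (`[0%R, 1%R]%classic : set R) < +oo)%E -> measurable_fun (`[0, 1] : set R) f ->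
  (forall x, 0 <= x <= 1 -> `|f x| <= M) ->
  mu.-integrable `[0, 1] (EFin \o f).
Proof.
move=> mu_fin mf fM; apply: measurable_bounded_integrable => //.
exists M; split; first exact: num_real.
by move=> N MN x /=; rewrite in_itv /= => x01; rewrite (le_trans (fM _ x01))// ltW.
Qed.

Lemma lebesgue_itv01_lty (R : realType) :
  (lebesgue_measure (`[0%R, 1%R]%classic : set R) < +oo)%E.
Proof. by rewrite lebesgue_measure_itv /= lte01 -EFinB ltry. Qed.

Lemma probability_itv01_lty (R : realType) (P : distr R) :
  (P `[0%R, 1%R]%classic < +oo)%E.
Proof. by rewrite (le_lt_trans (probability_le1 _ _))// ltry. Qed.

Lemma integrable_scaler d (T : measurableType d) (R : realType)
    (mu : {measure set T -> \bar R}) (D : set T) (k : R) (f : T -> R) :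
  measurable D -> mu.-integrable D (EFin \o f) ->
  mu.-integrable D (EFin \o (fun x => k * f x)).
Proof.
move=> mD intf; have := integrableZl mD k intf.
by congr (mu.-integrable _ _); apply/funext => x; rewrite /= EFinM.
Qed.

Lemma integrable_addr d (T : measurableType d) (R : realType)
    (mu : {measure set T -> \bar R}) (D : set T) (f g : T -> R) :
  measurable D -> mu.-integrable D (EFin \o f) ->
  mu.-integrable D (EFin \o g) ->
  mu.-integrable D (EFin \o (fun x => f x + g x)).
Proof.
move=> mD intf intg; have := integrableD mD intf intg.
by congr (mu.-integrable _ _); apply/funext => x; rewrite /= EFinD.
Qed.

Lemma nondecreasing_integrable01 (R : realType)
    (mu : {measure set (measurableTypeR R) -> \bar R}) (f : R -> R) :
  (mu (`[0%R, 1%R]%classic : set R) < +oo)%E ->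
  {in `[0, 1] &, {homo f : x y / x <= y}} ->
  mu.-integrable `[0, 1] (EFin \o f).
Proof.
move=> mu_fin f_nd; apply: (@bounded_integrable01 _ _ _ (`|f 0| + `|f 1|)) => //.
  exact: nondecreasing_measurable01.
move=> t t01; have t01' : t \in `[0, 1] by rewrite in_itv.
case/andP: t01 => t0 t1.
have f0t : f 0 <= f t by apply: f_nd; rewrite // in_itv/= lexx ler01.
have ft1 : f t <= f 1 by apply: f_nd; rewrite // in_itv/= lexx ler01.
have := ler_norm (f 1); have := ler_norm (- f 0); rewrite normrN => h0 h1.
by rewrite ler_norml; have := normr_ge0 (f 0); have := normr_ge0 (f 1); lra.
Qed.

(** * The payment identity *)

Lemma integral_increment_bounds (R : realType) (q : R -> R) (x y : R)
    (Q := fun v => \int[lebesgue_measure]_(t in `[0, v]) q t) :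
  {in `[0, 1] &, {homo q : x y / x <= y}} -> 0 <= x -> x <= y -> y <= 1 ->
  (y - x) * q x <= Q y - Q x <= (y - x) * q y.
Proof.
move=> q_nd x0 xy y1.
have sub : (`]x, y] : set R) `<=` `[0, 1].
  by move=> t /=; rewrite !in_itv/=; lra.
have int01 f : {in `[0, 1] &, {homo f : x y / x <= y}} ->
    lebesgue_measure.-integrable (`]x, y] : set R) (EFin \o f).
  move=> f_nd.
  by apply: integrableS (nondecreasing_integrable01 (lebesgue_itv01_lty R) f_nd).
have cst c : \int[lebesgue_measure]_(t in (`]x, y] : set R)) c = (y - x) * c.
  rewrite Rintegral_cst//= lebesgue_measure_itv /= lte_fin mulrC.
  by move: xy; rewrite le_eqVlt => /predU1P[->|->]; rewrite ?ltxx//= subrr.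
have -> : Q y - Q x = \int[lebesgue_measure]_(t in `]x, y]) q t.
  rewrite /Q Rintegral_itvB// ?bnd_simp//.
  apply: integrableS (nondecreasing_integrable01 (lebesgue_itv01_lty R) q_nd) => //.
  by move=> t /=; rewrite !in_itv/=; lra.
have q_ndxy s t : 0 <= s -> s <= t -> t <= 1 -> q s <= q t.
  by move=> s0 st t1; apply: q_nd; rewrite // in_itv/=; lra.
rewrite -!cst; apply/andP; split; apply: le_Rintegral => //;
  rewrite ?int01// => t; rewrite /= in_itv/= => /andP[xt ty]; apply: q_ndxy; lra.
Qed.

(** Summing the hypothesis over the n subintervals of length v / n telescopes
    to |D v - D 0| <= (v / n) (q v - q 0). *)
Lemma increment_bound_constant (R : realType) (D q : R -> R) (v : R) :
  0 <= v -> (forall x y, 0 <= x -> x <= y -> y <= v ->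
    `|D y - D x| <= (y - x) * (q y - q x)) ->
  D v = D 0.
Proof.
move=> v0 Dq.
have step n i : (i <= n.+1)%N ->
    `|D (i%:R * (v / n.+1%:R)) - D 0| <=
      v / n.+1%:R * (q (i%:R * (v / n.+1%:R)) - q 0).
  set h := v / n.+1%:R; have h0 : 0 <= h by rewrite divr_ge0.
  elim: i => [_|i IH ilt]; first by rewrite mul0r !subrr normr0 mulr0.
  have {}IH := IH (ltnW ilt).
  have ih : i.+1%:R * h = i%:R * h + h by rewrite -natr1 mulrDl mul1r.
  have ihv : i.+1%:R * h <= v.
    rewrite /h mulrCA ler_piMr// ler_pdivrMr ?ltr0n// mul1r ler_nat//.
  have := Dq (i%:R * h) (i.+1%:R * h) _ _ ihv.
  rewrite ih addrAC subrr add0r lerDl mulr_ge0//= => /(_ erefl h0) {}Dq.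
  rewrite [X in `|X|](_ : _ = (D (i%:R * h + h) - D (i%:R * h)) +
    (D (i%:R * h) - D 0)); last by ring.
  rewrite (le_trans (ler_normD _ _))//; lra.
have bound n : `|D v - D 0| <= v / n.+1%:R * (q v - q 0).
  by have := step n n.+1 (leqnn _); rewrite mulrCA divff ?mulr1.
apply/eqP; rewrite -subr_eq0 -normr_eq0; apply/eqP/le_anti.
rewrite normr_ge0 andbT leNgt; apply/negP => Dpos.
set C := v * (q v - q 0); set e := `|D v - D 0| in Dpos bound.
have := bound (Num.trunc (C / e)); rewrite mulrAC ler_pdivlMr ?ltr0n//.
by rewrite mulrC -ler_pdivlMr// leNgt truncnS_gt.
Qed.

(** Incentive compatibility: neither of two values gains by reporting the other,
    which bounds the difference of their payments on both sides. *)
Lemma direct_mechanism_incentive (R : realType) (q m : R -> R) (x y : R) :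
  direct_mechanism q m -> 0 <= x -> x <= y -> y <= 1 ->
  x * (q y - q x) <= m y - m x <= y * (q y - q x).
Proof.
move=> [_ q_nd mE] x0 xy y1.
have [x01 y01] : x \in `[0, 1] /\ y \in `[0, 1] by rewrite !in_itv/=; split; lra.
rewrite (mE x)// (mE y)//.
have := integral_increment_bounds q_nd x0 xy y1 => /=.
set Qy := Rintegral _ _ _; set Qx := Rintegral _ _ _; lra.
Qed.

(** The envelope formula: incentive compatibility makes the information rent
    x q x - m x a primitive of q. *)
Lemma incentive_direct_mechanism (R : realType) (q m : R -> R) :
  (forall v, 0 <= v <= 1 -> 0 <= q v <= 1) -> m 0 = 0 ->
  (forall x y, 0 <= x -> x <= y -> y <= 1 ->
    x * (q y - q x) <= m y - m x <= y * (q y - q x)) ->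
  direct_mechanism q m.
Proof.
move=> q01 m0 ic.
have q_nd : {in `[0, 1] &, {homo q : x y / x <= y}}.
  move=> x y; rewrite !in_itv/= => /andP[x0 _] /andP[_ y1].
  rewrite le_eqVlt => /predU1P[->//|xy]; rewrite -subr_ge0.
  have := ic x y x0 (ltW xy) y1 => /andP[/le_trans h /h].
  by rewrite -subr_ge0 -mulrBl pmulr_rge0// subr_gt0.
split=> // v; rewrite in_itv/= => /andP[v0 v1].
set Q := fun v => \int[lebesgue_measure]_(t in `[0, v]) q t.
have := @increment_bound_constant _ (fun v => v * q v - Q v - m v) q v v0.
rewrite /= mul0r m0.
have -> : Q 0 = 0 by rewrite /Q set_itv1 Rintegral_set1.
rewrite !subr0 => H; rewrite -/(Q v); suff : v * q v - Q v - m v = 0 by lra.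
apply: H => x y x0 xy yv; have y1 := le_trans yv v1.
have := integral_increment_bounds q_nd x0 xy y1; have := ic x y x0 xy y1.
by rewrite /= -/(Q x) -/(Q y) ler_norml; lra.
Qed.

Lemma direct_mechanism_nondecreasing (R : realType) (q m : R -> R) :
  direct_mechanism q m -> {in `[0, 1] &, {homo m : x y / x <= y}}.
Proof.
move=> qm x y; rewrite !in_itv/= => /andP[x0 x1] /andP[y0 y1] xy.
have [_ q_nd _] := qm; have := direct_mechanism_incentive qm x0 xy y1.
have : q x <= q y by apply: q_nd; rewrite // in_itv/= ?x0 ?y0.
rewrite -subr_ge0 => qxy /andP[h _].
by rewrite -subr_ge0 (le_trans _ h)// mulr_ge0.
Qed.

(** * Survival functions and expectations *)

Lemma survivalE (R : realType) (P : distr R) (x : R) :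
  P `]x, +oo[%classic = (survival P x)%:E.
Proof.
rewrite -setCitvl probability_setC// /survival EFinB fineK//.
exact: fin_num_measure.
Qed.

Lemma survival_ge0 (R : realType) (P : distr R) (x : R) : 0 <= survival P x.
Proof. by rewrite -lee_fin -survivalE. Qed.

Lemma survival_le1 (R : realType) (P : distr R) (x : R) : survival P x <= 1.
Proof. by rewrite -lee_fin -survivalE probability_le1. Qed.

Lemma survival_nonincreasing (R : realType) (P : distr R) (x y : R) :
  x <= y -> survival P y <= survival P x.
Proof.
move=> xy; rewrite -lee_fin -!survivalE le_measure ?inE//.
by apply: subset_itvr; rewrite bnd_simp.
Qed.

Lemma survival_measurable (R : realType) (P : distr R) (D : set R) :
  measurable D -> measurable_fun D (survival P).
Proof.
move=> mD; apply: nonincreasing_measurable => // x y.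
exact: survival_nonincreasing.
Qed.

Lemma supported01_null (R : realType) (P : distr R) (A : set R) :
  supported01 P -> measurable A -> A `&` `[0, 1] = set0 -> P A = 0%E.
Proof.
move=> P01 mA A01; apply/eqP; rewrite -measure_le0.
have <- : P (~` `[0%R, 1%R]%classic) = 0%E.
  by rewrite probability_setC// P01 subee.
apply: le_measure; rewrite ?inE//; first exact: measurableC.
by move=> t At t01; have : set0 t by rewrite -A01.
Qed.

Lemma survival_supported (R : realType) (P : distr R) (x : R) :
  supported01 P -> 1 <= x -> survival P x = 0.
Proof.
move=> P01 x1; apply: EFin_inj; rewrite -survivalE supported01_null//.
by apply/seteqP; split => // t /= []; rewrite !in_itv/=; lra.
Qed.

Lemma supported01_restrict (R : realType) (P : distr R) (A : set R) :
  supported01 P -> measurable A -> P (`[0, 1] `&` A) = P A.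
Proof.
move=> P01 mA.
have D0 : P (A `\` `[0%R, 1%R]) = 0%E.
  apply: supported01_null => //; first exact: measurableD.
  by rewrite setDE -setIA setICl setI0.
have := measureDI P mA (measurable_itv `[0, 1]).
by rewrite setIC => ->; rewrite -[LHS]add0e; congr (_ + _)%E; rewrite -D0.
Qed.

(** Both sides are the product measure of the set of pairs (v, x) with v in
    [0, 1], x in U and x < v. *)
Lemma tail_integral (R : realType) (P : distr R) (U : set R) :
  supported01 P -> measurable U ->
  (\int[P]_(v in `[0%R, 1%R]) lebesgue_measure (U `&` `]-oo, v[) =
   \int[lebesgue_measure]_(x in U) (survival P x)%:E)%E.
Proof.
move=> P01 mU; pose T := measurableTypeR R.
pose A : set (T * T) := (`[0, 1] `*` U) `&` [set z | z.2 < z.1].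
have mA : measurable A.
  apply: measurableI; first exact: measurableX.
  have : measurable_fun [set: T * T] (fun z : T * T => z.2 < z.1).
    exact: measurable_fun_ltr.
  by move=> /(_ measurableT [set true]); rewrite setTI; exact.
have := indic_fubini_tonelli P lebesgue_measure mA.
rewrite indic_fubini_tonelli_FE// indic_fubini_tonelli_GE// => fub.
rewrite [LHS]integral_mkcond [RHS]integral_mkcond.
transitivity (\int[P]_v (lebesgue_measure \o xsection A) v)%E.
  apply: eq_integral => v _ /=; rewrite patchE.
  case: ifPn => [|] v01.
    congr (lebesgue_measure _); apply/seteqP; split => x /=.
      rewrite in_itv/= => -[Ux xv]; apply/xsectionP; split => //.
      by split => //; exact/set_mem.
    by move/xsectionP => [[_ /= Ux] /= xv]; rewrite in_itv.
  rewrite (_ : xsection A v = set0) ?measure0//.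
  apply/seteqP; split => // x /xsectionP [[/= v01' _] _].
  by case/negP: v01; exact/mem_set.
rewrite [LHS]fub; apply: eq_integral => x _ /=; rewrite patchE.
case: ifPn => [/set_mem|] Ux.
  rewrite -survivalE -(supported01_restrict P01)//.
  congr (P _); apply/seteqP; split => v /=.
    by move/ysectionP => [[/= v01 _] /= xv]; split => //; rewrite in_itv/= xv.
  by rewrite !in_itv/= andbT => -[v01 xv]; apply/ysectionP.
rewrite (_ : ysection A x = set0) ?measure0//.
apply/seteqP; split => // v /ysectionP [[_ /= Ux'] _].
by case/negP: Ux; exact/mem_set.
Qed.

Lemma expect_tail (R : realType) (P : distr R) (U : set R) :
  supported01 P -> measurable U -> U `<=` `[0, 1] ->
  expect P (fun v => fine (lebesgue_measure (U `&` `]-oo, v[))) =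
  \int[lebesgue_measure]_(x in U) survival P x.
Proof.
move=> P01 mU U01; rewrite /expect /Rintegral -tail_integral//; congr fine.
apply: eq_integral => v _; rewrite fineK// ge0_fin_numE//.
apply: le_lt_trans (lebesgue_itv01_lty R); apply: le_measure; rewrite ?inE//.
  exact: measurableI.
by move=> x [/U01].
Qed.

Lemma mean_tail (R : realType) (P : distr R) :
  supported01 P -> mean P = \int[lebesgue_measure]_(x in `[0, 1]) survival P x.
Proof.
move=> P01; rewrite -expect_tail//; apply: eq_Rintegral => v.
rewrite inE/= in_itv/= => /andP[v0 v1].
rewrite (_ : _ `&` _ = `[0, v[)%classic; last first.
  by apply/seteqP; split => x /=; rewrite !in_itv/=; lra.
rewrite lebesgue_measure_itv /= lte_fin.
case: ltP => [_|v0'] /=; first by rewrite subr0.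
by apply: (@le_anti _ R); rewrite v0 v0'.
Qed.

(** * Revenue when posted prices earn little *)

Lemma integrable_sumr d (T : measurableType d) (R : realType)
    (mu : {measure set T -> \bar R}) (D : set T) (I : Type) (s : seq I)
    (f : I -> T -> R) :
  measurable D -> (forall i, mu.-integrable D (EFin \o f i)) ->
  mu.-integrable D (EFin \o (fun x => \sum_(i <- s) f i x)).
Proof.
move=> mD intf; have := @integrable_sum _ _ _ mu _ mD _ s xpredT _ (fun i _ => intf i).
by congr (mu.-integrable _ _); apply/funext => v; rewrite /= sumEFin.
Qed.

Lemma Rintegral_sum d (T : measurableType d) (R : realType)
    (mu : {measure set T -> \bar R}) (D : set T) (I : Type) (s : seq I)
    (f : I -> T -> R) :
  measurable D -> (forall i, mu.-integrable D (EFin \o f i)) ->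
  \int[mu]_(x in D) (\sum_(i <- s) f i x) =
  \sum_(i <- s) \int[mu]_(x in D) f i x.
Proof.
move=> mD intf; rewrite /Rintegral.
under eq_integral do rewrite -sumEFin.
rewrite integral_sum//; apply: EFin_inj; rewrite -sumEFin.
rewrite (_ : \sum_(i <- s) _ =
    \sum_(i <- s) (fine (\int[mu]_(x in D) (f i x)%:E))%:E)%E.
  by rewrite sumEFin.
by apply: eq_bigr => i _; rewrite fineK//; have := integrable_fin_num mD (intf i).
Qed.

Lemma probability01_integrable (R : realType) (P : distr R) (f : R -> R)
    (M : R) :
  measurable_fun (`[0, 1] : set R) f ->
  (forall x, 0 <= x <= 1 -> `|f x| <= M) ->
  P.-integrable `[0, 1] (EFin \o f).
Proof.
move=> mf fM; apply: (bounded_integrable01 _ mf fM).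
exact: probability_itv01_lty.
Qed.

Lemma direct_mechanism0 (R : realType) (q m : R -> R) :
  direct_mechanism q m -> m 0 = 0.
Proof.
move=> [_ _ ->]; last by rewrite in_itv/= lexx ler01.
by rewrite mul0r set_itv1 Rintegral_set1 subrr.
Qed.

(** Raising the allocation by dq at value x raises the revenue by at most
    x dq times the probability that the value exceeds x.  On a grid of mesh
    1 / n.+1 the payment increment over a cell is at most its right endpoint
    times the allocation increment, which costs an extra 1 / n.+1. *)
Lemma revenue_upper_bound (R : realType) (P : distr R) (q m : R -> R) (p : R) :
  supported01 P -> direct_mechanism q m ->
  (forall x, 0 <= x <= 1 -> x * survival P x <= p) -> expect P m <= p.
Proof.
move=> P01 qm Pp.
have [q01 q_nd _] := qm; have m_nd := direct_mechanism_nondecreasing qm.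
have m0 := direct_mechanism0 qm.
suff bound n : expect P m <= p + n.+1%:R^-1.
  rewrite leNgt; apply/negP; rewrite -subr_gt0 => pos.
  have := bound (Num.trunc (expect P m - p)^-1).
  rewrite -lerBlDl leNgt => /negP; apply.
  by rewrite invf_plt ?posrE ?ltr0n// truncnS_gt.
set N := n.+1; pose x i : R := i%:R / N%:R.
have N0 : (0 : R) < N%:R by rewrite ltr0n.
have x01 i : (i <= N)%N -> x i \in `[0, 1].
  by move=> iN; rewrite in_itv/= divr_ge0//= ler_pdivrMr// mul1r ler_nat.
have xS i : x i.+1 = x i + N%:R^-1 by rewrite /x -natr1 mulrDl mul1r.
have x_lt i : x i < x i.+1 by rewrite xS ltrDl invr_gt0.
have x_le i j : (i <= j)%N -> x i <= x j.
  by move=> ij; rewrite /x ler_pM2r ?invr_gt0// ler_nat.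
pose c i := x i.+1 * (q (x i.+1) - q (x i)).
have dq i : (i < N)%N -> 0 <= q (x i.+1) - q (x i).
  by move=> iN; rewrite subr_ge0 q_nd ?x01// ?(ltnW iN)// ltW.
have c0 i : (i < N)%N -> 0 <= c i.
  by move=> iN; rewrite mulr_ge0 ?dq//; have := x01 _ iN; rewrite in_itv => /andP[].
have dm i : (i < N)%N -> m (x i.+1) - m (x i) <= c i.
  move=> iN; have := x01 _ iN; have := x01 _ (ltnW iN); rewrite !in_itv/=.
  move=> /andP[xi0 _] /andP[_ xi1].
  by have /andP[] := direct_mechanism_incentive qm xi0 (ltW (x_lt i)) xi1.
pose b i v : R := c i * (x i < v)%R%:R.
have m_le k v : (k <= N)%N -> 0 <= v -> v <= x k -> m v <= \sum_(0 <= i < k) b i v.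
  elim: k => [_ v0 vk|k IH kN v0 vk].
    rewrite big_nil; suff -> : v = 0 by rewrite m0.
    by apply/le_anti; rewrite v0 (le_trans vk)// /x mul0r.
  have [vk'|kv] := leP v (x k).
    rewrite big_nat_recr//= (le_trans (IH (ltnW kN) v0 vk'))// lerDl.
    by rewrite mulr_ge0// c0.
  have v01 : v \in `[0, 1].
    rewrite in_itv/= v0 (le_trans vk)//.
    by have := x01 _ kN; rewrite in_itv => /andP[].
  rewrite (le_trans (m_nd _ _ v01 (x01 _ kN) vk))//.
  have {1}-> : m (x k.+1) = \sum_(0 <= i < k.+1) (m (x i.+1) - m (x i)).
    by rewrite (telescope_sumr (fun i => m (x i)))// /x mul0r m0 subr0.
  rewrite big_nat_cond [leRHS]big_nat_cond ler_sum// => i /andP[/andP[_ ik] _].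
  rewrite /b (le_lt_trans _ kv) ?x_le// mulr1 dm//.
  exact: leq_trans kN.
have intb i : P.-integrable `[0, 1] (EFin \o b i).
  apply: (@probability01_integrable _ _ _ `|c i|).
    rewrite /b; apply: measurable_funM => //.
    apply: nondecreasing_measurable => // s t st.
    by case: ltP => // /lt_le_trans/(_ st)->.
  by move=> v _; rewrite normrM ler_piMr// normr_nat; case: (_ < _).
have intm : P.-integrable `[0, 1] (EFin \o m).
  by apply: nondecreasing_integrable01 => //; exact: probability_itv01_lty.
have Eb i : \int[P]_(v in `[0, 1]) b i v = c i * survival P (x i).
  rewrite /b RintegralZl//; last first.
    apply: (@probability01_integrable _ _ _ 1).
      apply: nondecreasing_measurable => // s t st.
      by case: ltP => // /lt_le_trans/(_ st)->.
    by move=> v _; rewrite normr_nat; case: (_ < _).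
  congr (_ * _); apply: EFin_inj; rewrite -survivalE -(supported01_restrict P01)//.
  rewrite setIC.
  rewrite /Rintegral (_ : \int[P]_(_ in _) _ = P (`]x i, +oo[ `&` `[0%R, 1%R]))%E.
    by rewrite fineK//; apply: fin_num_measure; exact: measurableI.
  rewrite -integral_indic//; apply: eq_integral => v _.
  rewrite indicE; congr ((nat_of_bool _)%:R%:E).
  by apply/idP/idP; rewrite inE/= in_itv/= andbT.
have -> : p + n.+1%:R^-1 = (p + N%:R^-1) * 1 by rewrite mulr1.
apply: (@le_trans _ _ (\sum_(0 <= i < N) c i * survival P (x i))).
  under eq_bigr do rewrite -Eb.
  rewrite -Rintegral_sum//; apply: le_Rintegral => //.
    exact: integrable_sumr.
  move=> v; rewrite /= in_itv/= => /andP[v0 v1]; apply: m_le => //.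
  by rewrite /x divff// gt_eqF.
have pN : 0 <= p + N%:R^-1.
  rewrite addr_ge0 ?invr_ge0 ?(ltW N0)//.
  by have := Pp 0; rewrite lexx ler01 mul0r; apply.
apply: (@le_trans _ _ (\sum_(0 <= i < N) (p + N%:R^-1) * (q (x i.+1) - q (x i)))).
  rewrite big_nat_cond [leRHS]big_nat_cond ler_sum// => i /andP[/andP[_ iN] _].
  rewrite /c mulrAC ler_wpM2r ?dq// xS mulrDl lerD//.
    by apply: Pp; have := x01 _ (ltnW iN); rewrite in_itv.
  by rewrite ler_piMr ?survival_le1// invr_ge0 ltW.
rewrite -mulr_sumr (telescope_sumr (fun i => q (x i)))// ler_wpM2l//.
have /andP[_ q1] := q01 _ (x01 _ (leqnn N)).
have /andP[q0 _] := q01 _ (x01 _ (leq0n N)).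
lra.
Qed.

(** * Distributions with a given survival function *)

Lemma survival_right_continuous (R : realType) (P : distr R) :
  right_continuous (survival P).
Proof.
pose X : {RV P >-> R} := HB.pack (idfun : measurableTypeR R -> R)
  (@isMeasurableFun.Build _ _ _ _ (idfun : measurableTypeR R -> R)
    (@measurable_id _ _ setT)).
move=> a; have /fine_cvg : cdf X x @[x --> a^'+] --> (fine (cdf X a))%:E.
  by rewrite fineK ?fin_num_measure//; exact: cdf_right_continuous.
move=> /(cvgB (cvg_cst (1 : R))); exact.
Qed.

(** The half-line below 0 is a countable union of half-lines ending at a negative
    number, which are null. *)
Lemma supported01_survival (R : realType) (P : distr R) :
  (forall x, x < 0 -> survival P x = 1) -> survival P 1 = 0 -> supported01 P.
Proof.
move=> P_neg P1; have PNy x : x < 0 -> P `]-oo, x]%classic = 0%E.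
  by move=> x0; rewrite -setCitvr probability_setC// survivalE P_neg// subee.
have : P.-negligible (~` `[0%R, 1%R]%classic).
  rewrite setCitv; apply: negligibleU.
    have : `]-oo, (0:R)[%classic `<=` \bigcup_n `]-oo, - n.+1%:R^-1 : R]%classic.
      move=> x /=; rewrite in_itv/= -oppr_gt0 => x0.
      exists (Num.trunc (- x)^-1) => //=; rewrite in_itv/= lerNr ltW//.
      by rewrite invf_plt ?posrE ?ltr0n// truncnS_gt.
    move=> h; apply: negligibleS; first exact: h.
    apply: negligible_bigcup => n.
    by apply/negligibleP => //; apply: PNy; rewrite oppr_lt0 invr_gt0.
  by apply/negligibleP => //; apply: etrans (survivalE P 1) _; rewrite P1.
move/negligibleP => /(_ (measurableC (measurable_itv _))) PC0.
rewrite /supported01 -[X in P X]setCK probability_setC ?PC0 ?sube0//.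
exact: measurableC.
Qed.

Lemma distr_of_survival (R : realType) (G : R -> R) :
  {homo G : x y / x <= y >-> y <= x} -> right_continuous G ->
  (forall x, x < 0 -> G x = 1) -> (forall x, 1 <= x -> G x = 0) ->
  exists2 P : distr R, supported01 P & survival P =1 G.
Proof.
move=> G_ni G_rc G_neg G1; pose F x := 1 - G x.
have F_nd : {homo F : x y / x <= y} by move=> x y /G_ni; rewrite lerD2l lerN2.
have F_rc : right_continuous F.
  by move=> a; have := cvgB (cvg_cst (1 : R)) (G_rc a); exact.
have F_Ny : F @ -oo --> (0 : R).
  apply: cvg_near_cst; near=> x.
  have x0 : x < 0 by near: x; exact: nbhs_ninfty_lt.
  by rewrite /F G_neg ?subrr.
have F_y : F @ +oo --> (1 : R).
  apply: cvg_near_cst; near=> x.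
  have x1 : 1 <= x by near: x; exact: nbhs_pinfty_ge.
  by rewrite /F G1 ?subr0.
pose C : cumulativeBounded (0 : R) 1 := HB.pack F
  (isCumulative.Build R _ R F F_nd F_rc)
  (isCumulativeBounded.Build R 0 1 F F_Ny F_y).
pose P : distr R := lebesgue_stieltjes_measure C.
have PE x : P `]-oo, x]%classic = (1 - G x)%:E := cdf_lebesgue_stieltjes_id C x.
have PG x : survival P x = G x by rewrite /survival PE /= opprB addrC subrK.
exists P => //; apply: supported01_survival => [x x0|]; first by rewrite PG G_neg.
by rewrite PG G1.
Unshelve. all: end_near. Qed.

Lemma survival_neg (R : realType) (P : distr R) (x : R) :
  supported01 P -> x < 0 -> survival P x = 1.
Proof.
move=> P01 x0; apply: EFin_inj; rewrite -survivalE; apply/eqP.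
rewrite eq_le probability_le1//= -P01 le_measure ?inE//.
by move=> t /=; rewrite !in_itv/=; lra.
Qed.

(** Among the distributions whose revenue at every posted price is at most p,
    this one has the largest survival function below that of P0; taking
    the maximum with p leaves the minimum unchanged, since p / x >= 1 for
    0 < x <= p. *)
Lemma truncated_distr (R : realType) (P0 : distr R) (p : R) :
  supported01 P0 -> 0 < p ->
  exists2 P : distr R, supported01 P &
    forall x, survival P x = Num.min (survival P0 x) (p / Num.max x p).
Proof.
move=> P01 p0.
have maxp x : 0 < Num.max x p by rewrite lt_max p0 orbT.
apply: distr_of_survival.
- move=> x y xy; apply: le_min2; first exact: survival_nonincreasing.
  by rewrite ler_pM2l// lef_pV2 ?posrE// le_max2.
- move=> a; have c : p / Num.max x p @[x --> a^'+] --> p / Num.max a p.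
    apply: cvg_within_filter; apply: cvgM; first exact: cvg_cst.
    apply: cvgV; first by rewrite gt_eqF.
    exact: (@continuous_max _ _ id (cst p) a (@cvg_id _ _) (@cvg_cst _ _ _ _ _)).
  apply: (cvg_comp2 (@survival_right_continuous _ P0 a) c).
  exact: (@min_continuous _ R (survival P0 a, p / Num.max a p)).
- move=> x x0; rewrite max_r ?divff ?gt_eqF ?min_l ?survival_neg//.
  by rewrite ltW// (lt_trans x0).
- move=> x x1; rewrite survival_supported// min_l// divr_ge0 ?(ltW p0)//.
  exact: ltW.
Qed.

(** * The level sets of a distribution *)

Definition level_set (R : realType) (P0 : distr R) (p : R) : set R :=
  [set x | 0 <= x <= 1 /\ p / x < survival P0 x].

Lemma level_set_sub01 (R : realType) (P0 : distr R) (p : R) :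
  level_set P0 p `<=` `[0, 1].
Proof. by move=> x [x01 _]; rewrite /= in_itv. Qed.

Lemma level_set_measurable (R : realType) (P0 : distr R) (p : R) :
  measurable (level_set P0 p).
Proof.
rewrite (_ : level_set P0 p = `[0%R, 1%R]%classic `&`
    (fun x => p / x < survival P0 x) @^-1` [set true]).
  apply: (@measurable_fun_ltr _ _ _ (`[0%R, 1%R]%classic : set (measurableTypeR R))) => //.
    by apply: measurable_funM => //; exact: inv_measurable01.
  exact: survival_measurable.
by apply/seteqP; split => x; rewrite /level_set /= in_itv.
Qed.

Lemma lebesgue01_integrable (R : realType) (f : R -> R) (M : R) :
  measurable_fun (`[0, 1] : set R) f ->
  (forall x, 0 <= x <= 1 -> `|f x| <= M) ->
  lebesgue_measure.-integrable (`[0, 1] : set R) (EFin \o f).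
Proof.
by move=> mf fM; apply: (bounded_integrable01 _ mf fM); exact: lebesgue_itv01_lty.
Qed.

Lemma excess_integrable (R : realType) (P0 : distr R) (p : R) : 0 <= p ->
  lebesgue_measure.-integrable (`[0, 1] : set R)
    (EFin \o fun x => Num.max (survival P0 x - p / x) 0).
Proof.
move=> p0; apply: (@lebesgue01_integrable _ _ 1).
  apply: measurable_maxr => //; apply: measurable_funB.
    exact: survival_measurable.
  by apply: measurable_funM => //; exact: inv_measurable01.
move=> x /andP[x0 x1]; rewrite ger0_norm ?le_max ?lexx ?orbT//.
rewrite ge_max ler01 andbT lerBlDr (le_trans (survival_le1 _ _))// lerDl.
by rewrite divr_ge0.
Qed.

Lemma level_weight_integrable (R : realType) (P0 : distr R) (p : R) : 0 < p ->
  lebesgue_measure.-integrable (`[0, 1] : set R)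
    (EFin \o fun x => \1_(level_set P0 p) x * x^-1).
Proof.
move=> p0; apply: (@lebesgue01_integrable _ _ p^-1).
  apply: measurable_funM; last exact: inv_measurable01.
  by apply: measurable_indic; exact: level_set_measurable.
move=> x /andP[x0 x1]; rewrite indicE; case: (boolP (x \in _)).
  rewrite inE => -[_ xG]; rewrite mul1r ger0_norm ?invr_ge0//.
  rewrite -(ler_pM2l p0) divff ?gt_eqF//.
  by rewrite (le_trans (ltW xG))// survival_le1.
by move=> _; rewrite mul0r normr0 invr_ge0 ltW.
Qed.

Lemma level_survival_integrable (R : realType) (P0 P : distr R) (p : R) :
  lebesgue_measure.-integrable (`[0, 1] : set R)
    (EFin \o fun x => \1_(level_set P0 p) x * survival P x).
Proof.
apply: (@lebesgue01_integrable _ _ 1).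
  apply: measurable_funM; last exact: survival_measurable.
  by apply: measurable_indic; exact: level_set_measurable.
move=> x _; rewrite indicE ger0_norm ?mulr_ge0 ?survival_ge0//.
by rewrite mulr_ile1 ?survival_ge0 ?survival_le1//; case: (_ \in _).
Qed.

Lemma dist_integrable (R : realType) (P P0 : distr R) :
  lebesgue_measure.-integrable (`[0, 1] : set R)
    (EFin \o fun x => `|survival P x - survival P0 x|).
Proof.
apply: (@lebesgue01_integrable _ _ 1).
  apply: measurableT_comp => //.
  by apply: measurable_funB; exact: survival_measurable.
move=> x _; rewrite normr_id ler_norml.
have := survival_ge0 P x; have := survival_le1 P x.
have := survival_ge0 P0 x; have := survival_le1 P0 x; lra.
Qed.

Lemma Rintegral_level_set (R : realType) (P0 : distr R) (p : R) (f : R -> R) :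
  \int[lebesgue_measure]_(x in level_set P0 p) f x =
  \int[lebesgue_measure]_(x in `[0, 1]) (\1_(level_set P0 p) x * f x).
Proof.
rewrite -{1}(setIidr (@level_set_sub01 _ P0 p)) Rintegral_mkcondr.
apply: eq_Rintegral => x _; rewrite patchE indicE.
by case: (x \in level_set P0 p); rewrite ?mul1r ?mul0r.
Qed.

Lemma indic_level_set (R : realType) (P0 : distr R) (p x : R) : 0 <= x <= 1 ->
  \1_(level_set P0 p) x = (p / x < survival P0 x)%R%:R :> R.
Proof.
move=> x01; rewrite indicE; congr (nat_of_bool _)%:R.
by apply/idP/idP => [|h]; rewrite inE => // -[].
Qed.

(** On the level set the survival function of P0 exceeds p / x by the
    integrand of the excess, and that of P differs from it by at most the distance. *)
Lemma level_survival_lower_bound (R : realType) (P0 P : distr R) (p : R) :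
  0 < p ->
  excess P0 p + p * \int[lebesgue_measure]_(x in level_set P0 p) x^-1 <=
  \int[lebesgue_measure]_(x in level_set P0 p) survival P x + dist P P0.
Proof.
move=> p0; rewrite !Rintegral_level_set.
have iw := level_weight_integrable P0 p0.
have ie := excess_integrable P0 (ltW p0).
have isv := level_survival_integrable P0 P p.
have id := dist_integrable P P0.
have ipw : lebesgue_measure.-integrable (`[0, 1] : set R)
    (EFin \o fun x => p * (\1_(level_set P0 p) x * x^-1)).
  exact: integrable_scaler.
rewrite /excess /dist -RintegralZl// -!RintegralD//.
apply: le_Rintegral => //.
- exact: integrable_addr.
- exact: integrable_addr.
- move=> x; rewrite /= in_itv/= => x01; rewrite indic_level_set//.
  have := ler_norm (survival P x - survival P0 x).
  have := ler_norm (- (survival P x - survival P0 x)); rewrite normrN.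
  have := survival_ge0 P x.
  case: ltP => /= h; rewrite ?mul1r ?mul0r ?mulr0.
    by rewrite max_l ?subr_ge0 ?(ltW h)//; lra.
  by rewrite max_r ?subr_le0//; lra.
Qed.

(** [excess P0] lies above a line through p, whose slope is minus the integral
    of 1 / x over the level set; the gap integrand is at least eps wherever the
    posted-price revenue lies between p and p' and eps away from p'. *)
Lemma excess_tangent (R : realType) (P0 : distr R) (p p' eps c d : R) :
  0 < p -> 0 <= p' -> 0 <= c -> c < d -> d <= 1 -> 0 < eps ->
  (forall x, c < x < d ->
     p' + eps <= x * survival P0 x <= p \/ p < x * survival P0 x <= p' - eps) ->
  excess P0 p + p * \int[lebesgue_measure]_(x in level_set P0 p) x^-1 <
  excess P0 p' + p' * \int[lebesgue_measure]_(x in level_set P0 p) x^-1.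
Proof.
move=> p0 p'0 c0 cd d1 eps0 gap; rewrite !Rintegral_level_set.
have iw := level_weight_integrable P0 p0.
have ie := excess_integrable P0 (ltW p0).
have ie' := excess_integrable P0 p'0.
have ipw k : lebesgue_measure.-integrable (`[0, 1] : set R)
    (EFin \o fun x => k * (\1_(level_set P0 p) x * x^-1)).
  exact: integrable_scaler.
pose bump x : R := eps * \1_`]c, d[%classic x.
have ib : lebesgue_measure.-integrable (`[0, 1] : set R) (EFin \o bump).
  apply: (@lebesgue01_integrable _ _ eps).
    by apply: measurable_funM => //; exact: measurable_indic.
  move=> x _; rewrite ger0_norm; last by rewrite mulr_ge0 ?(ltW eps0).
  by rewrite ler_piMr ?(ltW eps0)// indicE; case: (_ \in _).
have bumpE : \int[lebesgue_measure]_(x in (`[0, 1] : set R)) bump x = eps * (d - c).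
  rewrite RintegralZl//; last first.
    apply: (@lebesgue01_integrable _ _ 1); first exact: measurable_indic.
    by move=> x _; rewrite ger0_norm// indicE; case: (_ \in _).
  congr (_ * _); rewrite /Rintegral integral_indic//= setIidl.
    by rewrite lebesgue_measure_itv /= lte_fin cd.
  by move=> x /=; rewrite !in_itv/=; lra.
rewrite -subr_gt0; apply: (@lt_le_trans _ _ (eps * (d - c))).
  by rewrite mulr_gt0// subr_gt0.
rewrite lerBrDl -bumpE /excess -!RintegralZl// -!RintegralD//; last exact: integrable_addr.
apply: le_Rintegral => //.
- by apply: integrable_addr => //; exact: integrable_addr.
- exact: integrable_addr.
move=> x; rewrite /= in_itv/= => x01; rewrite indic_level_set//.
have [x0|x0] := leP x 0.
  have -> : x = 0 by apply/le_anti; rewrite x0; case/andP: x01.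
  rewrite invr0 !mulr0 !subr0 /bump indicE memNset ?mulr0 ?addr0//.
  by rewrite /= in_itv/=; lra.
have x1 : 1 <= x^-1 by rewrite invf_ge1//; case/andP: x01.
set G := survival P0 x.
have lep k : (k / x < G)%R = (k < x * G) by rewrite ltr_pdivrMr// mulrC.
have lep' k : (k / x <= G)%R = (k <= x * G) by rewrite ler_pdivrMr// mulrC.
have gep' k : (G <= k / x)%R = (x * G <= k) by rewrite ler_pdivlMr// mulrC.
have epsx : eps <= eps / x by rewrite ler_pMr.
rewrite lep /bump indicE; set y := x * G.
have maxl (a : R) : a <= Num.max a 0 by rewrite le_max lexx.
have maxr (a : R) : 0 <= Num.max a 0 by rewrite le_max lexx orbT.
have := maxl (G - p' / x); have := maxr (G - p' / x).
have gapx := gap x; rewrite -/G -/y in gapx.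
case: ltP => [py|yp] /=; rewrite ?mul1r ?mul0r ?mulr0.
  have -> : Num.max (G - p / x) 0 = G - p / x by rewrite max_l// subr_ge0 lep' ltW.
  case: (boolP (x \in _)) => [|_]; last by rewrite mulr0; lra.
  rewrite inE/= in_itv/= mulr1 => /gapx[/andP[_]|/andP[_ yp']].
    by rewrite leNgt py.
  by move: yp'; rewrite -gep' mulrBl; lra.
have -> : Num.max (G - p / x) 0 = 0 by rewrite max_r// subr_le0 gep'.
case: (boolP (x \in _)) => [|_]; last by rewrite mulr0; lra.
rewrite inE/= in_itv/= mulr1 => /gapx[/andP[p'y _]|/andP[py _]].
  by move: p'y; rewrite -lep' mulrDl; lra.
by rewrite ltNge yp in py.
Qed.

(** * Posted prices and the range of the excess *)

Lemma dist_truncated (R : realType) (P P0 : distr R) (p : R) : 0 < p ->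
  (forall x, survival P x = Num.min (survival P0 x) (p / Num.max x p)) ->
  dist P P0 = excess P0 p.
Proof.
move=> p0 PE; rewrite /dist /excess.
rewrite -[LHS]Rintegral_itv_obnd_cbnd; last first.
  apply: integrableS (dist_integrable P P0) => //.
  exact: subset_itv_oc_cc.
rewrite -[RHS]Rintegral_itv_obnd_cbnd; last first.
  apply: integrableS (excess_integrable P0 (ltW p0)) => //.
  exact: subset_itv_oc_cc.
apply: eq_Rintegral => x; rewrite inE/= in_itv/= => /andP[x0 x1].
have G1 := survival_le1 P0 x; rewrite PE.
have [xp|px] := leP x p.
  have h1 : 1 <= p / x by rewrite ler_pdivlMr// mul1r.
  rewrite divff ?gt_eqF// min_l// subrr normr0 max_r//.
  by rewrite subr_le0 (le_trans G1).
case: (leP (survival P0 x) (p / x)) => h.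
  by rewrite subrr normr0 max_r// subr_le0.
by rewrite max_l ?subr_ge0 ?(ltW h)// distrC ger0_norm// subr_ge0 ltW.
Qed.

Lemma truncated_revenue (R : realType) (P P0 : distr R) (p x : R) : 0 < p ->
  survival P x = Num.min (survival P0 x) (p / Num.max x p) ->
  0 <= x -> x * survival P x <= p.
Proof.
move=> p0 -> x0; have maxp : 0 < Num.max x p by rewrite lt_max p0 orbT.
apply: (@le_trans _ _ (x * (p / Num.max x p))).
  by rewrite ler_wpM2l// ge_min lexx orbT.
by rewrite mulrCA ler_piMr ?(ltW p0)// ler_pdivrMr// mul1r le_max lexx.
Qed.

Lemma Pi0_has_sup (R : realType) (P0 : distr R) :
  has_sup [set x * fine (P0 `[x, +oo[%classic) | x in `[0, 1]].
Proof.
split.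
  by exists (0 * fine (P0 `[0, +oo[%classic)), 0; rewrite //= in_itv/= lexx ler01.
exists 1 => _ [x /=] /[!in_itv]/= /andP[x0 x1] <-.
rewrite mulr_ile1 ?fine_ge0//.
by rewrite -lee_fin fineK ?fin_num_measure// probability_le1.
Qed.

Lemma posted_price_le_Pi0 (R : realType) (P0 : distr R) (x : R) :
  0 <= x <= 1 -> x * survival P0 x <= Pi0 P0.
Proof.
move=> x01; apply: (@le_trans _ _ (x * fine (P0 `[x, +oo[%classic))).
  rewrite ler_wpM2l//; first by case/andP: x01.
  rewrite -lee_fin fineK ?fin_num_measure// -survivalE le_measure ?inE//.
  by apply: subset_itvr; rewrite bnd_simp.
by apply: ub_le_sup; [case: (Pi0_has_sup P0)|exists x; rewrite //= in_itv].
Qed.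

(** As x grows, x (1 - F0 x) jumps only downwards and rises at most at unit
    speed, so it spends positive time between two levels on its way up. *)
Lemma posted_price_crossing (R : realType) (P0 : distr R) (a b : R) :
  0 <= a -> a < b -> b < Pi0 P0 ->
  exists c d : R, [/\ 0 <= c, c < d, d <= 1 &
    forall x, c < x < d -> a <= x * survival P0 x <= b].
Proof.
move=> a0 ab bPi.
pose E := [set y | 0 <= y <= 1 /\ b <= y * survival P0 y].
have Eb y : E y -> b <= y.
  move=> [/andP[y0 _]] /le_trans; apply.
  by rewrite ler_piMr// survival_le1.
have E0 : E !=set0.
  have := sup_adherent _ (Pi0_has_sup P0) => /(_ (Pi0 P0 - b)).
  rewrite subr_gt0 => /(_ bPi)[_ [x /=] /[!in_itv]/= /andP[x0 x1] <-].
  rewrite -/(Pi0 P0) subKr; set g := fine _ => bxg.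
  have b0 : 0 < b by exact: le_lt_trans ab.
  have g0 : 0 < g.
    rewrite lt_neqAle fine_ge0// andbT; apply: contraTneq bxg => <-.
    by rewrite mulr0 -leNgt ltW.
  have xg : b / g < x by rewrite ltr_pdivrMr.
  pose y := (b / g + x) / 2.
  have yx : y < x by rewrite /y; lra.
  have y0 : b / g < y by rewrite /y; lra.
  have y00 : 0 <= y by apply: le_trans (ltW y0); apply: divr_ge0; exact: ltW.
  exists y; split; first by rewrite y00 (le_trans (ltW yx)).
  apply: (@le_trans _ _ (y * g)); first by rewrite -ler_pdivrMr//; exact: ltW.
  rewrite ler_wpM2l// -lee_fin fineK ?fin_num_measure// -survivalE le_measure ?inE//.
  by apply: subset_itvr; rewrite bnd_simp.
have lE : has_lbound E by exists b.
have hE : has_inf E by split.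
pose z := inf E.
have zb : b <= z by apply: lb_le_inf.
have z1 : z <= 1.
  by have [y Ey] := E0; rewrite (le_trans (ge_inf lE Ey))//; case: Ey => /andP[].
(* z is the first point where b is reached; just before it a is exceeded *)
exists (z - (b - a)), z; split => //; [lra|lra|].
move=> x /andP[zx xz]; have x0 : 0 <= x by lra.
have [y Ey yx] : exists2 y, E y & y < x + (b - a).
  have eps0 : 0 < x + (b - a) - z by lra.
  have [y Ey yz] := inf_adherent eps0 hE.
  by exists y => //; move: yz; rewrite -/z; lra.
have zy : z <= y := ge_inf lE Ey.
have Gyx : survival P0 y <= survival P0 x by apply: survival_nonincreasing; lra.
have [y01 by_] := Ey; apply/andP; split.
  have : (y - x) * survival P0 x <= y - x by rewrite ler_piMr ?survival_le1//; lra.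
  have : y * survival P0 y <= y * survival P0 x by rewrite ler_wpM2l//; case/andP: y01.
  by rewrite mulrBl; lra.
rewrite leNgt; apply/negP => bx; have : z <= x.
  by apply: ge_inf => //; split; [rewrite x0; lra|exact: ltW].
by rewrite leNgt xz.
Qed.

Lemma Pi0_ge0 (R : realType) (P0 : distr R) : 0 <= Pi0 P0.
Proof.
rewrite (le_trans _ (@posted_price_le_Pi0 _ P0 0 _)) ?mul0r//.
by rewrite lexx ler01.
Qed.

Lemma Pi0_le1 (R : realType) (P0 : distr R) : Pi0 P0 <= 1.
Proof.
apply: ge_sup; first by case: (Pi0_has_sup P0).
move=> _ [x /=] /[!in_itv]/= /andP[x0 x1] <-.
rewrite mulr_ile1 ?fine_ge0//.
by rewrite -lee_fin fineK ?fin_num_measure// probability_le1.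
Qed.

Lemma excess_ge0 (R : realType) (P0 : distr R) (p : R) : 0 <= excess P0 p.
Proof. by apply: Rintegral_ge0 => x _; rewrite le_max lexx orbT. Qed.

Lemma excess_0 (R : realType) (P0 : distr R) :
  supported01 P0 -> excess P0 0 = mean P0.
Proof.
move=> P01; rewrite mean_tail//; apply: eq_Rintegral => x _.
by rewrite mul0r subr0 max_l// survival_ge0.
Qed.

Lemma excess_Pi0 (R : realType) (P0 : distr R) (p : R) :
  Pi0 P0 <= p -> excess P0 p = 0.
Proof.
move=> Pip; have p0 := le_trans (Pi0_ge0 P0) Pip.
rewrite /excess -Rintegral_itv_obnd_cbnd; last first.
  apply: integrableS (excess_integrable P0 p0) => //.
  exact: subset_itv_oc_cc.
rewrite -[RHS](@Rintegral_set0 _ _ _ lebesgue_measure (cst (0 : R))).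
rewrite [RHS]Rintegral_mkcond [LHS]Rintegral_mkcond.
apply: eq_Rintegral => x _; rewrite !patchE in_set0; case: ifPn => //.
rewrite inE/= in_itv/= => /andP[x0 x1].
rewrite max_r// subr_le0 ler_pdivlMr// mulrC.
by rewrite (le_trans _ Pip)// posted_price_le_Pi0// (ltW x0).
Qed.

Lemma excess_continuous (R : realType) (P0 : distr R) (b : R) :
  {within `[0, b], continuous (excess P0)}.
Proof.
(* constant for negative levels, so that 1 dominates f on a neighbourhood of [0, b] *)
pose f (p x : R) := Num.max (survival P0 x - Num.max p 0 / x) 0.
have f_int p : lebesgue_measure.-integrable (`[0, 1] : set R) (EFin \o f p).
  by apply: excess_integrable; rewrite le_max lexx orbT.
have fcont x p : {for p, continuous (f ^~ x : R -> R^o)}.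
  apply: (@continuous_max _ _ (fun p : R => survival P0 x - Num.max p 0 / x)
    (cst 0)); last exact: cvg_cst.
  apply: cvgB; first exact: cvg_cst.
  apply: cvgM; last exact: cvg_cst.
  exact: (@continuous_max _ _ id (cst 0) p (@cvg_id _ _) (@cvg_cst _ _ _ _ _)).
have cf : {in `](-1), (b + 1)[%classic, continuous
    (fun p => \int[lebesgue_measure]_(x in `[0, 1]) f p x)}.
  apply: (@continuity_under_integral _ _ _ lebesgue_measure f `[0, 1] _ _ _ _ _ (cst 1)) => //.
  - apply: aeW => x _ p _; exact: fcont.
  - apply: (@lebesgue01_integrable _ _ 1); first exact: measurable_cst.
    by move=> x _; rewrite normr1.
  - move=> p _; apply: aeW => x /=; rewrite in_itv/= => /andP[x0 x1].
    rewrite /f ger0_norm ?le_max ?lexx ?orbT// ge_max ler01 andbT lerBlDr.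
    rewrite (le_trans (survival_le1 _ _))// lerDl divr_ge0//.
    by rewrite le_max lexx orbT.
apply: (@subspace_eq_continuous _ _ _ (fun p => \int[lebesgue_measure]_(x in `[0, 1]) f p x)).
  move=> p; rewrite inE/= in_itv/= => /andP[p0 _].
  by rewrite /f max_l.
apply: continuous_in_subspaceT => p; rewrite inE/= in_itv/= => pb.
by apply: cf; rewrite inE/= in_itv/=; lra.
Qed.

Lemma excess_attained (R : realType) (P0 : distr R) (r : R) :
  supported01 P0 -> 0 < r < mean P0 ->
  exists2 p, 0 < p < Pi0 P0 & excess P0 p = r.
Proof.
move=> P01 /andP[r0 rm].
have [|p] := IVT (Pi0_ge0 P0) (@excess_continuous _ P0 (Pi0 P0)) (v := r).
  rewrite excess_0// excess_Pi0// ge_min le_max (ltW r0) (ltW rm).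
  by rewrite orbT.
rewrite in_itv/= => /andP[p0 pPi] pr; exists p => //; rewrite !lt_neqAle p0 pPi !andbT.
apply/andP; split; apply/eqP => pE.
  by move: rm; rewrite -pr -pE excess_0// ltxx.
by move: r0; rewrite -pr pE excess_Pi0// ltxx.
Qed.

(** * Integrals over level intervals *)

(** A survival function is at most 1, so p / x <= 1 on the interval; a left
    endpoint 0 is excluded by points of the interval close to 0. *)
Lemma level_intervals_lo_ge (R : realType) (P0 : distr R) (p : R)
    (I : intervals R) (j : nat) :
  0 < p -> level_intervals P0 p I -> (1 <= j <= Defs.num I)%N -> p <= lo I j.
Proof.
move=> p0 [I01 _ _ Ip] jI; have [lo0 lohi hi1] := I01 j jI.
have small x : 0 < x -> lo I j <= x < hi I j -> p <= x.
  move=> x0 xI; have := le_trans (Ip j x jI xI) (survival_le1 P0 x).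
  by rewrite ler_pdivrMr// mul1r.
have [lo_gt0|lo_le0] := ltP 0 (lo I j); first by rewrite small// lexx.
have lo_eq0 : lo I j = 0 by apply/le_anti; rewrite lo_le0.
rewrite lo_eq0 in small lohi *.
pose x := Num.min (p / 2) (hi I j / 2).
have x0 : 0 < x by rewrite lt_min !divr_gt0.
have xhi : x < hi I j by rewrite gt_min; apply/orP; right; lra.
have := small x x0; rewrite (ltW x0) xhi le_min => /(_ isT)/andP[]; lra.
Qed.

Lemma level_intervals_ordered (R : realType) (P0 : distr R) (p : R)
    (I : intervals R) (i j : nat) :
  level_intervals P0 p I -> (1 <= i)%N -> (i < j)%N -> (j <= Defs.num I)%N ->
  hi I i < lo I j.
Proof.
move=> [I01 Iord _ _] i1; elim: j => // j IH; rewrite ltnS leq_eqVlt.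
move=> /predU1P[<- iI|ij jI]; first by rewrite Iord// i1.
have j1 : (1 <= j)%N by rewrite (leq_trans i1)// ltnW.
apply: (lt_trans (IH ij (ltnW jI))).
have [|_ + _] := I01 j _; first by rewrite j1 ltnW.
by move=> /lt_trans; apply; rewrite Iord// j1.
Qed.

(** The level set and the union of the intervals differ by finitely many points. *)
Lemma level_set_integral (R : realType) (P0 : distr R) (p : R)
    (I : intervals R) (f : R -> R) :
  level_intervals P0 p I -> measurable_fun (`[0, 1] : set R) f ->
  (forall x, 0 <= x <= 1 -> 0 <= f x) ->
  (\int[lebesgue_measure]_(x in level_set P0 p) (f x)%:E =
   \sum_(1 <= j < (Defs.num I).+1)
     \int[lebesgue_measure]_(x in `[lo I j, hi I j]) (f x)%:E)%E.
Proof.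
move=> Ip mf f0; have [I01 _ Ifin _] := Ip.
pose s := index_iota 1 (Defs.num I).+1.
pose F j : set (measurableTypeR R) :=
  if (1 <= j <= Defs.num I)%N then `]lo I j, hi I j[%classic else set0.
have mF j : measurable (F j) by rewrite /F; case: ifPn.
pose V := \big[setU/set0]_(j <- s) F j.
have VE : V = [set x | exists2 j, (1 <= j <= Defs.num I)%N & lo I j < x < hi I j].
  rewrite /V -bigcup_seq; apply/seteqP; split => x /=.
    by move=> [j _]; rewrite /F; case: ifPn => // jI /=; rewrite in_itv; exists j.
  move=> [j jI xj]; exists j; first by rewrite /= mem_index_iota ltnS.
  by rewrite /F jI /= in_itv.
have V01 : V `<=` `[0, 1].
  rewrite VE => x /= [j /I01[lo0 _ hi1] /andP[lox xhi]]; rewrite in_itv/=.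
  by rewrite (le_trans lo0 (ltW lox)) (le_trans (ltW xhi)).
pose N := [set 0; 1] `|` ([set x | 0 < x < 1 /\ p / x < survival P0 x] `+` V).
have N_fin : finite_set N.
  by rewrite finite_setU; split; [exact: finite_set2|rewrite VE].
have N0 : lebesgue_measure N = 0%E.
  by apply: countable_lebesgue_measure0; exact: finite_set_countable.
pose T := measurableTypeR R.
have mN : measurable (N : set T).
  by apply: countable_measurable => //; exact: finite_set_countable.
have mV : measurable (V : set T) by exact: bigsetU_measurable.
have mf01 D : D `<=` (`[0, 1] : set R) -> measurable_fun (D : set T) (EFin \o f).
  by move=> D01; apply: measurable_funS D01 _ => //; exact/measurable_EFinP.
have f0' D : D `<=` (`[0, 1] : set R) -> forall x, D x -> (0 <= (f x)%:E)%E.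
  by move=> D01 x /D01; rewrite /= in_itv/= => /f0; rewrite lee_fin.
have U01 := @level_set_sub01 _ P0 p.
have UV : level_set P0 p `\` N = V `\` N.
  apply/seteqP; split => x [].
    move=> [x01 px] xN; split => //; apply: contrapT => xV; apply: xN.
    have [->|x0] := eqVneq x 0; first by left; left.
    have [->|x1] := eqVneq x 1; first by left; right.
    right; left; split => //; split => //.
    by rewrite !lt_neqAle eq_sym x0 x1.
  move=> xV xN; split => //; have := V01 _ xV; rewrite /= in_itv/= => x01.
  split => //; rewrite ltNge; apply/negP => px; apply: xN; right; right.
  by split => //= -[_]; rewrite ltNge px.
transitivity (\int[lebesgue_measure]_(x in V) (f x)%:E)%E.
  rewrite (ge0_negligible_integral mN _ (mf01 _ U01) (f0' _ U01) N0);
    last exact: level_set_measurable.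
  by rewrite UV -(ge0_negligible_integral mN _ (mf01 _ V01) (f0' _ V01) N0).
rewrite ge0_integral_bigsetU//; last 4 first.
- exact: iota_uniq.
- move=> i j _ _ [x []]; rewrite /F; case: ifPn => // iI; case: ifPn => // jI.
  rewrite /= !in_itv/= => /andP[lix xhi] /andP[ljx xhj].
  case: (ltngtP i j) => // ij.
    have := level_intervals_ordered Ip (proj1 (andP iI)) ij (proj2 (andP jI)).
    by move=> /lt_trans/(_ ljx)/lt_trans/(_ xhi); rewrite ltxx.
  have := level_intervals_ordered Ip (proj1 (andP jI)) ij (proj2 (andP iI)).
  by move=> /lt_trans/(_ lix)/lt_trans/(_ xhj); rewrite ltxx.
- exact: mf01.
- exact: f0'.
rewrite big_nat_cond [RHS]big_nat_cond; apply: eq_bigr => j /andP[jI _].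
rewrite /F -ltnS jI; have [lo0 _ hi1] := I01 j jI.
rewrite integral_itv_bndo_bndc ?integral_itv_obnd_cbnd//.
- by apply: mf01 => x; rewrite /= !in_itv/=; lra.
- by apply: mf01 => x; rewrite /= !in_itv/=; lra.
Qed.

Lemma integral_inv (R : realType) (u w : R) : 0 < u -> u < w ->
  (\int[lebesgue_measure]_(x in `[u, w]) (x^-1)%:E = (ln (w / u))%:E)%E.
Proof.
move=> u0 uw; have w0 := lt_trans u0 uw.
rewrite (continuous_FTC2 (F := @ln R) uw).
- by rewrite ln_div ?posrE// EFinB.
- apply: continuous_in_subspaceT => x; rewrite inE/= in_itv/= => /andP[ux _].
  apply: cvgV; last exact: cvg_id.
  by rewrite gt_eqF// (lt_le_trans u0).
- split.
  + move=> x; rewrite in_itv/= => /andP[ux _].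
    by have /(@ex_derive _ _ _ _ _ _ _) := is_derive1_ln (lt_trans u0 ux).
  + by apply: cvg_at_right_filter; exact: continuous_ln.
  + by apply: cvg_at_left_filter; exact: continuous_ln.
- move=> x; rewrite in_itv/= => /andP[ux _].
  rewrite derive1E.
  by have /(@derive_val _ _ _ _ _ _ _) := is_derive1_ln (lt_trans u0 ux).
Qed.

Lemma level_set_weight (R : realType) (P0 : distr R) (p : R)
    (I : intervals R) : 0 < p -> level_intervals P0 p I ->
  \int[lebesgue_measure]_(x in level_set P0 p) x^-1 = sum_log I.
Proof.
move=> p0 Ip; rewrite /Rintegral (level_set_integral Ip).
- rewrite /sum_log -[RHS]/(fine (_%:E)) -sumEFin; congr fine.
  rewrite big_nat_cond [RHS]big_nat_cond; apply: eq_bigr => j /andP[jI _].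
  rewrite ltnS in jI; have [I01 _ _ _] := Ip; have [_ lohi _] := I01 j jI.
  by rewrite integral_inv// (lt_le_trans p0)// (level_intervals_lo_ge p0 Ip).
- exact: inv_measurable01.
- by move=> x /andP[x0 _]; rewrite invr_ge0.
Qed.

(** * The mechanism of a level *)

Definition clamp (R : realType) (u w v : R) : R := Num.max u (Num.min v w).

Lemma level_set_below (R : realType) (P0 : distr R) (p : R)
    (I : intervals R) (v : R) : level_intervals P0 p I ->
  fine (lebesgue_measure (level_set P0 p `&` `]-oo, v[)) =
  \sum_(1 <= j < (Defs.num I).+1) (clamp (lo I j) (hi I j) v - lo I j).
Proof.
move=> Ip; pose f : R -> R := \1_`]-oo, v[.
have -> : lebesgue_measure (level_set P0 p `&` `]-oo, v[) =
    (\int[lebesgue_measure]_(x in level_set P0 p) (f x)%:E)%E.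
  by rewrite integral_indic 1?setIC//; exact: level_set_measurable.
rewrite (level_set_integral Ip) => [|//|//].
- rewrite -[RHS]/(fine (_%:E)) -sumEFin; congr fine.
  rewrite big_nat_cond [RHS]big_nat_cond; apply: eq_bigr => j /andP[jI _].
  rewrite ltnS in jI; have [I01 _ _ _] := Ip; have [_ lohi _] := I01 j jI.
  rewrite integral_indic//= /clamp.
  have [vh|hv] := leP v (hi I j).
    rewrite (_ : _ `&` _ = `[lo I j, v[%classic); last first.
      by apply/seteqP; split => x /=; rewrite !in_itv/=; lra.
    rewrite lebesgue_measure_itv /= lte_fin.
    by case: ltP => //; rewrite subrr.
  rewrite (_ : _ `&` _ = `[lo I j, hi I j]%classic); last first.
    by apply/seteqP; split => x /=; rewrite !in_itv/=; lra.
  by rewrite lebesgue_measure_itv /= lte_fin lohi max_r// ltW.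
- exact: measurable_indic.
Qed.

Lemma clamp_ge (R : realType) (u w v : R) : u <= clamp u w v.
Proof. by rewrite /clamp le_max lexx. Qed.

Lemma clamp_le (R : realType) (u w v : R) : u <= w -> clamp u w v <= w.
Proof. by move=> uw; rewrite /clamp ge_max uw ge_min lexx orbT. Qed.

Lemma clamp_nondecreasing (R : realType) (u w x y : R) :
  x <= y -> clamp u w x <= clamp u w y.
Proof. by move=> xy; rewrite /clamp le_max2// le_min2. Qed.

Lemma clamp_lo (R : realType) (u w v : R) : v <= u -> clamp u w v = u.
Proof. by move=> vu; rewrite /clamp max_l// ge_min vu. Qed.

Lemma clamp_hi (R : realType) (u w v : R) : u <= w -> w <= v -> clamp u w v = w.
Proof. by move=> uw wv; rewrite /clamp min_r// max_r. Qed.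

Lemma clamp_id (R : realType) (u w v : R) : u <= v -> v <= w -> clamp u w v = v.
Proof. by move=> uv vw; rewrite /clamp min_l// max_r. Qed.

(** The graph of ln lies below its tangents at x and at y. *)
Lemma ln_increment_bounds (R : realType) (x y : R) : 0 < x -> x <= y ->
  x * (ln y - ln x) <= y - x <= y * (ln y - ln x).
Proof.
move=> x0 xy; have y0 := lt_le_trans x0 xy.
have ln_sub (s t : R) : 0 < s -> 0 < t -> s * (ln t - ln s) <= t - s.
  move=> s0 t0; rewrite -ln_div ?posrE// mulrC -ler_pdivlMr//.
  have -> : t / s = 1 + (t - s) / s by field; rewrite gt_eqF.
  by apply: le_ln1Dx; rewrite ltr_pdivlMr// mulN1r; lra.
apply/andP; split; first exact: ln_sub.
by have := ln_sub _ _ y0 x0; rewrite -opprB mulrN; lra.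
Qed.

(** If the clamped value moves from X to Y, then x <= X and Y <= y, which reduces
    the claim to the bounds for X and Y. *)
Lemma clamp_incentive (R : realType) (u w x y : R)
    (X := clamp u w x) (Y := clamp u w y) :
  0 < u -> u <= w -> x <= y ->
  x * (ln (Y / u) - ln (X / u)) <= Y - X <= y * (ln (Y / u) - ln (X / u)).
Proof.
move=> u0 uw xy.
have X0 : 0 < X := lt_le_trans u0 (clamp_ge _ _ _).
have XY : X <= Y := clamp_nondecreasing _ _ xy.
have Y0 : 0 < Y := lt_le_trans X0 XY.
rewrite !ln_div ?posrE// opprB addrA subrK.
have /andP[lnl lnr] := ln_increment_bounds X0 XY.
have [XYe|XYn] := eqVneq X Y; first by rewrite XYe !subrr !mulr0 lexx.
have {XYn}XY' : X < Y by rewrite lt_neqAle XYn.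
have xX : x <= X.
  rewrite leNgt; apply/negP => Xx; move: XY'; rewrite ltNge => /negP; apply.
  have wx : w <= x.
    rewrite leNgt; apply/negP => xw; move: Xx.
    by rewrite ltNge /X /clamp min_l ?(ltW xw)// le_max lexx orbT.
  by rewrite /X clamp_hi// clamp_le.
have Yy : Y <= y.
  rewrite leNgt; apply/negP => yY; move: XY'; rewrite ltNge => /negP; apply.
  have yu : y <= u.
    rewrite leNgt; apply/negP => uy; move: yY.
    by rewrite ltNge /Y /clamp ge_max (ltW uy) ge_min lexx.
  by rewrite /Y clamp_lo// clamp_ge.
have D0 : 0 <= ln Y - ln X by rewrite subr_ge0 ler_ln ?posrE.
apply/andP; split; first by rewrite (le_trans _ lnl)// ler_wpM2r.
by rewrite (le_trans lnr)// ler_wpM2r.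
Qed.

Lemma sum_nat_prefix (V : zmodType) (n k : nat) (F G : nat -> V) :
  (1 <= k <= n.+1)%N -> (forall i, (1 <= i < k)%N -> F i = G i) ->
  (forall i, (k <= i <= n)%N -> F i = 0) ->
  \sum_(1 <= i < n.+1) F i = \sum_(1 <= i < k) G i.
Proof.
move=> /andP[k1 kn] FG F0; rewrite (big_cat_nat k1 kn)/=.
rewrite [X in _ + X]big_nat_cond [X in _ + X]big1 ?addr0.
  by apply: eq_big_nat => i; exact: FG.
by move=> i /andP[/F0].
Qed.

(** One formula covers all the cases of [mech]: intervals below v contribute in
    full, those above v nothing. *)
Lemma mech_clamp (R : realType) (P0 : distr R) (p a v : R) (I : intervals R) :
  0 < p -> level_intervals P0 p I -> 0 <= v < 1 ->
  mech I a v =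
   (a * \sum_(1 <= j < (Defs.num I).+1) ln (clamp (lo I j) (hi I j) v / lo I j),
    a * \sum_(1 <= j < (Defs.num I).+1) (clamp (lo I j) (hi I j) v - lo I j)).
Proof.
move=> p0 Ip /andP[v0 v1]; have [I01 _ _ _] := Ip.
have lo0 j : (1 <= j <= Defs.num I)%N -> 0 < lo I j.
  by move=> /(level_intervals_lo_ge p0 Ip); exact: lt_le_trans.
have lohi j : (1 <= j <= Defs.num I)%N -> lo I j < hi I j by case/I01.
have ordI i j : (1 <= i)%N -> (i < j)%N -> (j <= Defs.num I)%N -> hi I i < lo I j.
  exact: level_intervals_ordered Ip.
pose C j := clamp (lo I j) (hi I j) v.
have Clo j : (1 <= j <= Defs.num I)%N -> v <= lo I j ->
    ln (C j / lo I j) = 0 /\ C j - lo I j = 0.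
  by move=> jI vj; rewrite /C clamp_lo// divff ?ln1 ?subrr// gt_eqF// lo0.
have Chi j : (1 <= j <= Defs.num I)%N -> hi I j <= v -> C j = hi I j.
  by move=> jI vj; rewrite /C clamp_hi// ltW// lohi.
rewrite /mech lt_eqF//; case: pickP => [j|none1].
  rewrite /lo_ext /hi_ext; case: (posnP j) => [->|j0].
    by move=> /andP[/le_lt_trans h /h]; rewrite ltxx.
  rewrite -ltnS ltn_ord => /andP[lov vhi].
  have jI : (1 <= j <= Defs.num I)%N by rewrite j0 -ltnS ltn_ord.
  have Cj : C j = v by rewrite /C clamp_id// ltW.
  have Cb i : (1 <= i < j)%N -> C i = hi I i.
    move=> /andP[i1 ij]; have iI : (1 <= i <= Defs.num I)%N.
      by rewrite i1 (leq_trans (ltnW ij))//; case/andP: jI.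
    by apply: Chi => //; rewrite (le_trans _ lov)// ltW// ordI//; case/andP: jI.
  have Ca i : (j < i <= Defs.num I)%N -> v <= lo I i.
    by move=> /andP[ji iI]; rewrite (le_trans (ltW vhi))// ltW// ordI.
  have rng : (1 <= j.+1 <= (Defs.num I).+1)%N by rewrite ltnS ltn_ord.
  congr (a * _, a * _).
    rewrite (sum_nat_prefix rng (fun i _ => erefl)); last first.
      move=> i /andP[ji iI]; apply: (proj1 (Clo _ _ (Ca _ _))); rewrite ?ji//.
      by rewrite iI (leq_trans _ ji).
    rewrite big_nat_recr//= -/(C j) Cj; congr (_ + _).
    by apply: eq_big_nat => i /Cb; rewrite -/(C i) => ->.
  rewrite (sum_nat_prefix rng (fun i _ => erefl)); last first.
    move=> i /andP[ji iI]; apply: (proj2 (Clo _ _ (Ca _ _))); rewrite ?ji//.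
    by rewrite iI (leq_trans _ ji).
  rewrite big_nat_recr//= -/(C j) Cj; congr (_ + _).
  by apply: eq_big_nat => i /Cb; rewrite -/(C i) => ->.
case: pickP => [j /andP[hiv vlo]|none2].
  have rng : (1 <= j.+1 <= (Defs.num I).+1)%N by rewrite ltnS ltn_ord.
  have Cb i : (1 <= i < j.+1)%N -> C i = hi I i.
    move=> /andP[i1]; rewrite ltnS => ij.
    have iI : (1 <= i <= Defs.num I)%N.
      by rewrite i1 (leq_trans ij)// -ltnS ltn_ord.
    apply: Chi => //; have j0 : (0 < j)%N by exact: leq_trans ij.
    move: hiv; rewrite /hi_ext gtn_eqF// => hiv.
    move: ij; rewrite leq_eqVlt => /predU1P[->//|ij].
    have jn : (j <= Defs.num I)%N by rewrite -ltnS ltn_ord.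
    rewrite (le_trans _ hiv)// ltW// (lt_trans (ordI _ _ i1 ij jn))//.
    by rewrite lohi// j0.
  have Ca i : (j.+1 <= i <= Defs.num I)%N -> v <= lo I i.
    move=> /andP[ji iI]; move: vlo; rewrite /lo_ext/= (leq_trans ji iI) => vlo.
    move: ji; rewrite leq_eqVlt => /predU1P[<-|ji]; first exact: ltW.
    rewrite ltW// (lt_trans vlo)//.
    have jI : (1 <= j.+1 <= Defs.num I)%N by rewrite (leq_trans (ltnW ji)).
    by rewrite (lt_trans (lohi _ jI))// ordI.
  congr (a * _, a * _).
    rewrite (sum_nat_prefix rng (fun i _ => erefl)); last first.
      move=> i /andP[ji iI]; apply: (proj1 (Clo _ _ (Ca _ _))); rewrite ?ji//.
      by rewrite iI (leq_trans _ ji).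
    by apply: eq_big_nat => i /Cb; rewrite -/(C i) => ->.
  rewrite (sum_nat_prefix rng (fun i _ => erefl)); last first.
    move=> i /andP[ji iI]; apply: (proj2 (Clo _ _ (Ca _ _))); rewrite ?ji//.
    by rewrite iI (leq_trans _ ji).
  by apply: eq_big_nat => i /Cb; rewrite -/(C i) => ->.
(* otherwise v is above every left endpoint, and the last one is u_(J+1) = 1 *)
have lo_le k : (k <= (Defs.num I).+1)%N -> lo_ext I k <= v.
  elim: k => // k IH kI; have := none1 (Ordinal kI); have := none2 (Ordinal kI).
  rewrite /= IH ?(ltnW kI)//= => h2 /negbT; rewrite -leNgt => h1.
  by move: h2; rewrite h1 => /negbT; rewrite -leNgt.
by have := lo_le _ (leqnn _); rewrite /lo_ext/= ltnn leNgt v1.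
Qed.

(** The choice of a removes the jump of the allocation at 1. *)
Lemma mech_clamp01 (R : realType) (P0 : distr R) (p v : R) (I : intervals R)
    (a := 1 / sum_log I) :
  0 < p -> level_intervals P0 p I -> 0 < sum_log I -> 0 <= v <= 1 ->
  mech I a v =
   (a * \sum_(1 <= j < (Defs.num I).+1) ln (clamp (lo I j) (hi I j) v / lo I j),
    a * \sum_(1 <= j < (Defs.num I).+1) (clamp (lo I j) (hi I j) v - lo I j)).
Proof.
move=> p0 Ip S0 /andP[v0]; rewrite le_eqVlt => /predU1P[->|v1]; last first.
  by rewrite (mech_clamp _ p0 Ip) ?v0.
have C1 j : (1 <= j < (Defs.num I).+1)%N -> clamp (lo I j) (hi I j) 1 = hi I j.
  rewrite ltnS => jI; have [I01 _ _ _] := Ip; have [_ /ltW ? ?] := I01 j jI.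
  by rewrite clamp_hi.
rewrite /mech eqxx; congr (_, _).
  under eq_big_nat do rewrite C1//.
  by rewrite -/(sum_log I) /a divrK// unitf_gt0.
by under [in RHS]eq_big_nat do rewrite C1//.
Qed.

Lemma mech_direct (R : realType) (P0 : distr R) (p : R) (I : intervals R)
    (a := 1 / sum_log I) :
  0 < p -> level_intervals P0 p I -> 0 < sum_log I ->
  direct_mechanism (mech_q I a) (mech_m I a).
Proof.
move=> p0 Ip S0; have a0 : 0 < a by rewrite divr_gt0.
have lo0 j : (1 <= j < (Defs.num I).+1)%N -> 0 < lo I j.
  by rewrite ltnS => /(level_intervals_lo_ge p0 Ip); exact: lt_le_trans.
have lohi j : (1 <= j < (Defs.num I).+1)%N -> lo I j <= hi I j.
  by rewrite ltnS => jI; have [I01 _ _ _] := Ip; have [_ /ltW] := I01 j jI.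
have mE v : 0 <= v <= 1 -> _ := fun v01 => mech_clamp01 p0 Ip S0 v01.
apply: incentive_direct_mechanism.
- move=> v v01; rewrite /mech_q mE//=; apply/andP; split.
    rewrite mulr_ge0 ?(ltW a0)// big_nat_cond sumr_ge0// => j /andP[jI _].
    by rewrite ln_ge0// ler_pdivlMr ?lo0// mul1r clamp_ge.
  rewrite -[leRHS](_ : a * sum_log I = 1); last by rewrite divrK// unitf_gt0.
  rewrite ler_pM2l// /sum_log big_nat_cond [leRHS]big_nat_cond.
  rewrite ler_sum// => j /andP[jI _].
  have c0 := lt_le_trans (lo0 _ jI) (clamp_ge (lo I j) (hi I j) v).
  rewrite ler_ln ?posrE ?divr_gt0 ?lo0//; last exact: lt_le_trans (lo0 _ jI) (lohi _ jI).
  by rewrite ler_pM2r ?invr_gt0 ?lo0// clamp_le// lohi.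
- rewrite /mech_m mE ?lexx ?ler01//= big_nat_cond big1 ?mulr0// => j /andP[jI _].
  by rewrite clamp_lo ?subrr// ltW// lo0.
- move=> x y x0 xy y1; rewrite /mech_m /mech_q.
  have x01 : 0 <= x <= 1 by rewrite x0 (le_trans xy).
  have y01 : 0 <= y <= 1 by rewrite y1 (le_trans x0).
  rewrite (mE x)// (mE y)//= -!mulrBr -!sumrB !(mulrCA _ a) !ler_pM2l// !mulr_sumr.
  apply/andP; split; rewrite big_nat_cond [leRHS]big_nat_cond;
    apply: ler_sum => j /andP[jI _]; rewrite opprB addrA subrK;
    by have /andP[] := clamp_incentive (lo0 _ jI) (lohi _ jI) xy.
Qed.

(** The payment is a times the Lebesgue measure of the level set below the
    value, so its expectation is a times the integral of the survival
    function over the level set. *)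
Lemma mech_revenue (R : realType) (P0 P : distr R) (p : R) (I : intervals R)
    (a := 1 / sum_log I) :
  0 < p -> level_intervals P0 p I -> 0 < sum_log I -> supported01 P ->
  expect P (mech_m I a) =
  a * \int[lebesgue_measure]_(x in level_set P0 p) survival P x.
Proof.
move=> p0 Ip S0 P01.
rewrite -(expect_tail P01 (@level_set_measurable _ P0 p) (@level_set_sub01 _ P0 p)).
rewrite /expect -RintegralZl//.
  apply: eq_Rintegral => v; rewrite inE/= in_itv/= => v01.
  by rewrite /mech_m (mech_clamp01 p0 Ip)//= (level_set_below v Ip).
apply: nondecreasing_integrable01; first exact: probability_itv01_lty.
move=> x y _ _ xy; rewrite !(level_set_below _ Ip) ler_sum// => j _.
by rewrite lerD2r clamp_nondecreasing.
Qed.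

Lemma mech_guarantee (R : realType) (P0 P : distr R) (p : R) (I : intervals R)
    (a := 1 / sum_log I) :
  0 < p -> level_intervals P0 p I -> 0 < sum_log I -> supported01 P ->
  p + a * (excess P0 p - dist P P0) <= expect P (mech_m I a).
Proof.
move=> p0 Ip S0 P01; rewrite (mech_revenue p0 Ip S0 P01).
have := level_survival_lower_bound P0 P p0; rewrite (level_set_weight p0 Ip) => h.
have pE : p = a * (p * sum_log I) by rewrite /a; field; rewrite gt_eqF.
rewrite {1}pE.
by rewrite -mulrDr ler_pM2l ?divr_gt0//; lra.
Qed.

(** * The trade-off between revenue and excess *)

(** The posted-price revenue takes values in the middle third between p and p' on
    an interval, where the gap to the line is positive. *)
Lemma excess_strict_tangent (R : realType) (P0 : distr R) (p p' : R) :
  0 < p <= Pi0 P0 -> 0 <= p' <= Pi0 P0 -> p' != p ->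
  excess P0 p + p * \int[lebesgue_measure]_(x in level_set P0 p) x^-1 <
  excess P0 p' + p' * \int[lebesgue_measure]_(x in level_set P0 p) x^-1.
Proof.
move=> /andP[p0 pPi] /andP[p'0 p'Pi]; rewrite neq_lt => /orP[] pp.
- have a0 : 0 <= p' + (p - p') / 3 by lra.
  have ab : p' + (p - p') / 3 < p' + 2 * (p - p') / 3 by lra.
  have bPi : p' + 2 * (p - p') / 3 < Pi0 P0 by lra.
  have [c [d [c0 cd d1 cross]]] := posted_price_crossing a0 ab bPi.
  have eps0 : 0 < (p - p') / 3 by lra.
  apply: (excess_tangent p0 p'0 c0 cd d1 eps0) => x /cross /andP[? ?]; left.
  by apply/andP; split; lra.
- have a0 : 0 <= p + (p' - p) / 3 by lra.
  have ab : p + (p' - p) / 3 < p + 2 * (p' - p) / 3 by lra.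
  have bPi : p + 2 * (p' - p) / 3 < Pi0 P0 by lra.
  have [c [d [c0 cd d1 cross]]] := posted_price_crossing a0 ab bPi.
  have eps0 : 0 < (p' - p) / 3 by lra.
  apply: (excess_tangent p0 p'0 c0 cd d1 eps0) => x /cross /andP[? ?]; right.
  by apply/andP; split; lra.
Qed.

Lemma rho_min (R : realType) (P0 : distr R) (k p : R) :
  p \in `[0, Pi0 P0] ->
  (forall p', p' \in `[0, Pi0 P0] ->
    p + k * excess P0 p <= p' + k * excess P0 p') ->
  rho P0 k = p + k * excess P0 p.
Proof.
move=> pI pmin.
have lb : lbound [set p + k * excess P0 p | p in `[0, Pi0 P0]]
    (p + k * excess P0 p).
  by move=> _ [p' p'I <-]; exact: pmin.
apply/le_anti/andP; split.
  by apply: ge_inf; [exists (p + k * excess P0 p)|exists p].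
by apply: lb_le_inf => //; exists (p + k * excess P0 p), p.
Qed.

Lemma rho_attained (R : realType) (P0 : distr R) (k : R) :
  exists2 p, p \in `[0, Pi0 P0] & rho P0 k = p + k * excess P0 p.
Proof.
have cont : {within `[0, Pi0 P0], continuous (fun p => p + k * excess P0 p)}.
  move=> x; apply: cvgD; first exact: (continuous_subspaceT (fun x => @cvg_id _ _)).
  apply: cvgM; first exact: cvg_cst.
  exact: excess_continuous.
have [p pI pmin] := EVT_min (Pi0_ge0 P0) cont.
by exists p => //; apply: rho_min.
Qed.

(** * The two optimal mechanisms *)

(** A positive excess forces the level below [Pi0 P0], and an excess less than
    the mean forces it above 0. *)
Lemma Pi_RO_spec (R : realType) (P0 : distr R) (r : R) :
  supported01 P0 -> 0 < r < mean P0 ->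
  0 < Pi_RO P0 r < Pi0 P0 /\ excess P0 (Pi_RO P0 r) = r.
Proof.
move=> P01 rb; have [r0 rm] := andP rb.
have : [set p : R | 0 <= p <= 1 /\ excess P0 p = r] (Pi_RO P0 r).
  apply: getPex; have [p /andP[p0 pPi] pr] := excess_attained P01 rb.
  by exists p; split => //; rewrite (ltW p0) (le_trans (ltW pPi))// Pi0_le1.
set p := Pi_RO P0 r => -[/andP[p0 p1] pr]; split => //; apply/andP; split.
  rewrite lt_neqAle p0 andbT; apply/eqP => pE.
  by move: rm; rewrite -pr -pE excess_0// ltxx.
by rewrite ltNge; apply/negP => /excess_Pi0 h; move: r0; rewrite -pr h ltxx.
Qed.

(** The supporting line of [excess P0] at p takes a negative value at [Pi0 P0],
    where the excess vanishes. *)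
Lemma sum_log_gt0 (R : realType) (P0 : distr R) (p : R) (I : intervals R) :
  0 < p < Pi0 P0 -> level_intervals P0 p I -> 0 < sum_log I.
Proof.
move=> /andP[p0 pPi] Ip.
have := @excess_strict_tangent _ P0 p (Pi0 P0).
rewrite p0 (ltW pPi) Pi0_ge0 lexx gt_eqF// => /(_ isT isT isT).
rewrite (level_set_weight p0 Ip) (excess_Pi0 (lexx (Pi0 P0))) add0r.
have := excess_ge0 P0 p.
move=> e0 h; rewrite -(@pmulr_rgt0 _ (Pi0 P0 - p)) ?subr_gt0// mulrBl; lra.
Qed.

(** The supporting line of [excess P0] at p has slope - sum_log I, which the
    coefficient 1 / sum_log I turns into - 1. *)
Lemma tradeoff_strict_min (R : realType) (P0 : distr R) (p p' : R)
    (I : intervals R) :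
  0 < p < Pi0 P0 -> level_intervals P0 p I -> 0 <= p' <= Pi0 P0 -> p' != p ->
  p + 1 / sum_log I * excess P0 p < p' + 1 / sum_log I * excess P0 p'.
Proof.
move=> pb Ip p'b p'p; have [p0 pPi] := andP pb; have S0 := sum_log_gt0 pb Ip.
have := @excess_strict_tangent _ P0 p p'.
rewrite p0 (ltW pPi) p'b p'p => /(_ isT isT isT); rewrite (level_set_weight p0 Ip).
have E q : q + 1 / sum_log I * excess P0 q =
    (excess P0 q + q * sum_log I) / sum_log I by field; rewrite gt_eqF.
by rewrite !E ltr_pM2r// invr_gt0.
Qed.

Lemma tradeoff_min (R : realType) (P0 : distr R) (p : R) (I : intervals R) :
  0 < p < Pi0 P0 -> level_intervals P0 p I ->
  rho P0 (1 / sum_log I) = p + 1 / sum_log I * excess P0 p.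
Proof.
move=> pb Ip; have [p0 pPi] := andP pb; apply: rho_min.
  by rewrite in_itv/= !ltW.
move=> p'; rewrite in_itv/= => p'b; have [->//|p'p] := eqVneq p' p.
exact/ltW/(tradeoff_strict_min pb Ip).
Qed.

Lemma pi_RS_tradeoff (R : realType) (P0 : distr R) (p : R) (I : intervals R) :
  0 < p < Pi0 P0 -> level_intervals P0 p I -> pi_RS P0 (1 / sum_log I) = p.
Proof.
move=> pb Ip; have rhoE := tradeoff_min pb Ip.
have : [set q : R | q \in `[0, Pi0 P0] /\
    q + 1 / sum_log I * excess P0 q = rho P0 (1 / sum_log I)]
  (pi_RS P0 (1 / sum_log I)).
  apply: getPex; exists p; split; last by rewrite rhoE.
  by case/andP: pb => p0 pPi; rewrite in_itv/= !ltW.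
set q := pi_RS _ _ => -[]; rewrite in_itv/= => qb qE.
apply/eqP; apply/negPn/negP => qp.
by have := tradeoff_strict_min pb Ip qb qp; rewrite qE rhoE ltxx.
Qed.

(** For k below the coefficient a, the level p already shows rho k < rho a.  For
    k above a, a minimizer at k is either p, whose value increases strictly with
    k since its excess is positive, or another level, whose value at a
    exceeds rho a strictly and does not decrease with k. *)
Lemma k_RS_tradeoff (R : realType) (P0 : distr R) (p : R) (I : intervals R) :
  0 < p < Pi0 P0 -> 0 < excess P0 p -> level_intervals P0 p I ->
  k_RS P0 (p + 1 / sum_log I * excess P0 p) = 1 / sum_log I.
Proof.
move=> pb e0 Ip; set a := 1 / sum_log I; set tau := p + a * _.
have [p0 pPi] := andP pb; have pI : p \in `[0, Pi0 P0] by rewrite in_itv/= !ltW.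
have a0 : 0 < a by rewrite divr_gt0// (sum_log_gt0 pb Ip).
have : [set k : R | 0 < k /\ rho P0 k = tau] (k_RS P0 tau).
  by apply: getPex; exists a; split => //; exact: tradeoff_min.
set k := k_RS _ _ => -[k0 kE]; have [ka|ak|//] := ltgtP k a.
- have : rho P0 k <= p + k * excess P0 p.
    apply: ge_inf; last by exists p.
    exists 0 => _ [q /=] /[!in_itv]/= /andP[q0 _] <-.
    by rewrite addr_ge0// mulr_ge0 ?excess_ge0// ltW.
  by rewrite kE /tau lerD2l ler_pM2r// leNgt ka.
- have [q] := rho_attained P0 k; rewrite in_itv/= kE => qb qE.
  have qexc := excess_ge0 P0 q.
  have [qp|qp] := eqVneq q p.
    have : a * excess P0 p < k * excess P0 p by rewrite ltr_pM2r.
    by move: qE; rewrite qp => /addrI ->; rewrite ltxx.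
  have := tradeoff_strict_min pb Ip qb qp; rewrite -/a -/tau qE ltrD2l.
  by rewrite ltNge ler_wpM2r// ltW.
Qed.

Lemma expect_m_RO_ge (R : realType) (P0 P : distr R) (I : R -> intervals R)
    (r : R) :
  supported01 P0 -> 0 < r < mean P0 ->
  (forall p : R, 0 <= p <= Pi0 P0 -> level_intervals P0 p (I p)) ->
  supported01 P ->
  Pi_RO P0 r + alpha_RO P0 I r * (r - dist P P0) <= expect P (m_RO P0 I r).
Proof.
move=> P01 rb Ilev PP; have [pb pr] := Pi_RO_spec P01 rb.
have [p0 pPi] := andP pb.
have Ip : level_intervals P0 (Pi_RO P0 r) (I (Pi_RO P0 r)).
  by apply: Ilev; rewrite !ltW.
by have := mech_guarantee p0 Ip (sum_log_gt0 pb Ip) PP; rewrite pr.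
Qed.

(** One distribution, the truncation of P0 at the robust revenue, is on the
    boundary of the ambiguity ball and bounds all mechanisms at once; it serves
    in both problems. *)
Lemma worst_case_distr (R : realType) (P0 : distr R) (r : R) :
  supported01 P0 -> 0 < r < mean P0 ->
  exists P : distr R, [/\ supported01 P, dist P P0 = r &
    forall q m, direct_mechanism q m -> expect P m <= Pi_RO P0 r].
Proof.
move=> P01 rb; have [/andP[p0 _] pr] := Pi_RO_spec P01 rb.
have [P PP PE] := truncated_distr P01 p0; exists P; split => //.
  by rewrite (dist_truncated p0 PE).
move=> q m qm; apply: (revenue_upper_bound PP qm) => x /andP[x0 _].
exact: truncated_revenue p0 (PE x) x0.
Qed.

Theorem theorem4 (R : realType) (P0 : distr R) (I : R -> intervals R)
    (r tau : R)
    (P0_supp : supported01 P0)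
    (I_level : forall p : R, 0 <= p <= Pi0 P0 -> level_intervals P0 p (I p))
    (r_bounds : 0 < r < mean P0)
    (tau_eq : tau = tau_equiv P0 I r) :
  [/\ RO_optimal P0 r (q_RO P0 I r) (m_RO P0 I r),
      RS_optimal P0 tau (q_RS P0 I tau) (m_RS P0 I tau) (k_RS P0 tau) &
      forall v : R, v \in `[0, 1] ->
        (q_RO P0 I r v, m_RO P0 I r v) = (q_RS P0 I tau v, m_RS P0 I tau v)].
Proof.
have [pb pr] := Pi_RO_spec P0_supp r_bounds.
have [r0 _] := andP r_bounds; have [p0 pPi] := andP pb.
have Ip : level_intervals P0 (Pi_RO P0 r) (I (Pi_RO P0 r)).
  by apply: I_level; rewrite !ltW.
have S0 := sum_log_gt0 pb Ip.
have a0 : 0 < alpha_RO P0 I r by rewrite divr_gt0.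
have tauE : tau = Pi_RO P0 r + alpha_RO P0 I r * r.
  by rewrite tau_eq /tau_equiv /alpha_RO mul1r mulrC.
have kE : k_RS P0 tau = alpha_RO P0 I r.
  by have := k_RS_tradeoff pb _ Ip; rewrite pr tauE => /(_ r0).
have piE : pi_RS P0 (k_RS P0 tau) = Pi_RO P0 r by rewrite kE; exact: pi_RS_tradeoff.
have qE : q_RS P0 I tau = q_RO P0 I r by rewrite /q_RS piE kE.
have mE : m_RS P0 I tau = m_RO P0 I r by rewrite /m_RS piE kE.
have guarantee := expect_m_RO_ge P0_supp r_bounds I_level.
have [Pw [Pw_supp Pw_dist Pw_max]] := worst_case_distr P0_supp r_bounds.
have direct : direct_mechanism (q_RO P0 I r) (m_RO P0 I r) := mech_direct p0 Ip S0.
have worst_le q m : direct_mechanism q m ->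
    (RO_worst_case P0 r m <= (Pi_RO P0 r)%:E)%E.
  move=> qm; apply: (@le_trans _ _ (expect Pw m)%:E);
    last by rewrite lee_fin (Pw_max _ _ qm).
  by apply: ereal_inf_lbound; exists Pw => //; split; rewrite // Pw_dist.
split.
- split => //; apply/le_anti/andP; split.
    by apply: ereal_sup_ubound; exists (q_RO P0 I r, m_RO P0 I r).
  apply: ge_ereal_sup => _ [[q m] /= qm <-]; apply: (le_trans (worst_le _ _ qm)).
  apply: le_ereal_inf_tmp => _ [P [PP Pr] <-]; rewrite lee_fin.
  by apply: le_trans (guarantee P PP); rewrite lerDl mulr_ge0 ?(ltW a0)// subr_ge0.
- rewrite /RS_optimal qE mE kE.
  have feas : RS_feasible P0 tau (q_RO P0 I r) (m_RO P0 I r) (alpha_RO P0 I r).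
    split => // P PP; have := guarantee P PP; rewrite tauE mulrBr; lra.
  split => //; apply/le_anti/andP; split; last first.
    apply: ereal_inf_lbound; exists (alpha_RO P0 I r) => //.
    by exists (q_RO P0 I r), (m_RO P0 I r).
  apply: le_ereal_inf_tmp => _ [k [q [m [qm k0 kfeas]]] <-]; rewrite lee_fin.
  have := kfeas Pw Pw_supp; have := Pw_max _ _ qm; rewrite Pw_dist tauE.
  move=> h1 h2; rewrite -(ler_pM2r r0); lra.
- by move=> v _; rewrite qE mE.
Qed.
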